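(* Let $\mathfrak{g}$ be a complex simple Lie algebra, and let $\mathfrak{q}$ be a maximal parabolic subalgebra of $\mathfrak{g}$ of quasi-Heisenberg type. Then the $\Omega_1$ system associated to $\mathfrak{q}$ is conformally invariant on the line bundle $\mathcal{L}_{s}$ ($s\in\mathbb{C}$) if and only if $s=0$.
   Context: Parabolic. Let $G$ be a complex, simple, connected, simply connected Lie group with Lie algebra $\mathfrak{g}$, $\mathfrak{b}=\mathfrak{h}\oplus\mathfrak{u}$ a Borel subalgebra with Cartan subalgebra $\mathfrak{h}$, $\Delta,\Delta^+,\Pi$ the roots, positive roots and simple roots, $\kappa$ the Killing form. For $\alpha_\mathfrak{q}\in\Pi$ let $\mathfrak{q}=\mathfrak{l}\oplus\mathfrak{n}\supset\mathfrak{b}$ be the standard maximal parabolic determined by $\alpha_\mathfrak{q}$: $\mathfrak{l}$ is $\mathfrak{h}$ plus the root spaces for roots in $\mathrm{span}(\Pi\setminus\{\alpha_\mathfrak{q}\})$, and $\mathfrak{n}$ is the sum of the root spaces for the remaining positive roots. $\mathfrak{q}$ is of quasi-Heisenberg type if $[\mathfrak{n},[\mathfrak{n},\mathfrak{n}]]=0$ and $\dim[\mathfrak{n},\mathfrak{n}]>1$. Grading by the coefficient of $\alpha_\mathfrak{q}$ in roots gives $\mathfrak{g}=\bigoplus_{j=-2}^{2}\mathfrak{g}(j)$ with $\mathfrak{l}=\mathfrak{g}(0)$, $\mathfrak{n}=\mathfrak{g}(1)\oplus\mathfrak{g}(2)$, $\bar{\mathfrak{n}}=\mathfrak{g}(-1)\oplus\mathfrak{g}(-2)$.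 $\Delta(W)$ denotes the roots whose root spaces lie in $W$. Let $Q=N_G(\mathfrak{q})=LN$. Bundle. Let $\mathfrak{g}_0$ be a real form of $\mathfrak{g}$ in which $\mathfrak{q}$ has a real form, $G_0\subset G$ the analytic subgroup with Lie algebra $\mathfrak{g}_0$, $Q_0=N_{G_0}(\mathfrak{q})=L_0N_0$, and $\bar N_0$ the unipotent subgroup opposite to $N_0$ (complexified Lie algebra $\bar{\mathfrak{n}}$). Let $\lambda_\mathfrak{q}$ be the fundamental weight of $\alpha_\mathfrak{q}$, $\chi_\mathfrak{q}$ the character of $L$ it exponentiates to, $\chi^s=|\chi_\mathfrak{q}|^s$ on $L_0$, extended trivially on $N_0$. $\mathcal{L}_s$ is the associated line bundle on $G_0/Q_0$, restricted to the open dense subset $\bar N_0Q_0/Q_0\cong\bar N_0$, where it is trivial with sections $C^\infty(\bar N_0,\mathbb{C}_{\chi^s})$. Write $Y=Y_{\bar{\mathfrak{n}}}+Y_\mathfrak{q}$ along $\mathfrak{g}=\bar{\mathfrak{n}}\oplus\mathfrak{q}$, and let $R$ be right differentiation $(R(X)f)(\bar n)=\frac{d}{dt}f(\bar n\exp(tX))|_{t=0}$, extended to $\mathcal{U}(\bar{\mathfrak{n}})$. $\mathfrak{g}$ acts on sections by $$(\pi_s(Y)f)(\bar n)=s\lambda_\mathfrak{q}\big((\mathrm{Ad}(\bar n^{-1})Y)_\mathfrak{q}\big)f(\bar n)-\big(R((\mathrm{Ad}(\bar n^{-1})Y)_{\bar{\mathfrak{n}}})f\big)(\bar n).$$ Conformal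 invariance. A list $D_1,\dots,D_m$ of differential operators on $\mathcal{L}_s$ is conformally invariant if it is linearly independent at each point of $\bar N_0$ and for each $X\in\mathfrak{g}$ there is a matrix $C(X)$ of smooth functions on $\bar N_0$ with $[\pi_s(X),D_i]=\sum_jC_{ji}(X)D_j$ for all $i$. Two lists are equivalent if related by an invertible matrix of smooth functions, $D_i'=\sum_jA_{ji}D_j$. $\Omega_1$ system. Let $\omega=\sum_jX_{j}^*\otimes X_j\in\mathfrak{g}(-2)\otimes\mathfrak{g}(2)$ with $\{X_j\}$ a basis of $\mathfrak{g}(2)$ and $\{X_j^*\}$ its $\kappa$-dual basis of $\mathfrak{g}(-2)$. Define $\tau_1:\mathfrak{g}(1)\to\mathfrak{g}(-1)\otimes\mathfrak{g}(2)$ by $\tau_1(X)=(\mathrm{ad}(X)\otimes\mathrm{Id})\omega$. For $Y^*\in(\mathfrak{g}(-1)\otimes\mathfrak{g}(2))^*\cong\mathfrak{g}(1)\otimes\mathfrak{g}(-2)$ (duality via $\kappa$) let $\tilde\tau_1(Y^* )(X)=Y^*(\tau_1(X))$, a linear form on $\mathfrak{g}(1)$, i.e. an element of $\mathfrak{g}(-1)$ via $\kappa$, and let $\Omega_1(Y^* )=R(\tilde\tau_1(Y^* ))$. The only irreducible $L$-constituent $V^*$ of $\mathfrak{g}(1)\otimes\mathfrak{g}(-2)$ with $\tilde\tau_1|_{V^*}\ne0$ is the one isomorphic to $\mathfrak{g}(-1)$. The $\Omega_1$ system is any list equivalent to $\Omega_1(Y_1^* ),\dots,\Omega_1(Y_m^*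 )$, with $\{Y_i^*\}$ a basis of that constituent; equivalently, up to equivalence it is the list $R(X_{-\alpha})$, $\alpha\in\Delta(\mathfrak{g}(1))$, with $X_{-\alpha}$ a nonzero root vector for $-\alpha$. *)

(* Defs.v *)
From HB Require Import structures.
From mathcomp Require Import all_boot all_order all_algebra.
From mathcomp Require Import complex.
From mathcomp Require Import all_classical all_reals all_analysis.

Set Implicit Arguments.
Unset Strict Implicit.
Unset Printing Implicit Defensive.

Import Order.TTheory GRing.Theory Num.Theory.
Import numFieldNormedType.Exports.
Import passmx.

Local Open Scope ring_scope.
Local Open Scope complex_scope.

Record lieAlg (F : fieldType) := LieAlg {
  lie_sort :> vectType F;
  br : lie_sort -> lie_sort -> lie_sort;
  br_linearl : forall z, linear (br^~ z);
  br_linearr : forall x, linear (br x);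
  br_alt : forall x, br x x = 0;
  br_jacobi : forall x y z,
    br x (br y z) + br y (br z x) + br z (br x y) = 0
}.

Section LieAlgebra.
Variables (F : fieldType) (g : lieAlg F).
Implicit Types (U V I : {vspace g}) (x y : g).

Definition ad x : 'End(g) := linfun (br x).

Lemma adE x y : ad x y = br x y.
Proof.
pose brx := GRing.isLinear.Build F g g _ (br x) (@br_linearr _ g x).
pose brL : {linear g -> g} := HB.pack (br x) brx.
exact: (lfunE brL).
Qed.

Definition brv U V : {vspace g} :=
  <<[seq br u v | u <- vbasis U, v <- vbasis V]>>%VS.

Definition is_ideal I := forall x y, y \in I -> br x y \in I.

Definition simple_lie :=
  (exists x y, br x y <> 0) /\
  (forall I, is_ideal I -> I = 0%VS \/ I = fullv).

Local Notation stdb := (vbasis (fullv : {vspace g})).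

Definition killing x y : F := \tr (mxof stdb stdb (ad x \o ad y)%VF).

(* g (x) g: a tensor is the matrix of its coefficients in the basis stdb. *)
Definition tens2 := 'M[F]_(\dim (fullv : {vspace g})).

Definition tens x y : tens2 := (rVof stdb x)^T *m rVof stdb y.

Definition tensv U V : {vspace tens2} :=
  <<[seq tens u v | u <- vbasis U, v <- vbasis V]>>%VS.

(* ad x (x) id and id (x) ad x *)
Definition adl x (T : tens2) : tens2 := (mxof stdb stdb (ad x))^T *m T.
Definition adr x (T : tens2) : tens2 := T *m mxof stdb stdb (ad x).

Lemma adl_tens x u v : adl x (tens u v) = tens (br x u) v.
Proof.
have B : basis_of {:g} stdb := vbasisP _.
by rewrite /adl /tens mulmxA -trmx_mul -(rVof_app _ B) adE.
Qed.

Lemma adr_tens x u v : adr x (tens u v) = tens u (br x v).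
Proof.
have B : basis_of {:g} stdb := vbasisP _.
by rewrite /adr /tens -mulmxA -(rVof_app _ B) adE.
Qed.

Definition killing_mx : tens2 := \matrix_(i, j) killing stdb`_i stdb`_j.

(* kappa (x) kappa, see [tpair_tens] *)
Definition tpair (T S : tens2) : F :=
  \tr (T^T *m killing_mx *m S *m killing_mx).

Lemma ad_linear : linear ad.
Proof.
move=> a x y; apply/lfunP => z.
by rewrite add_lfunE scale_lfunE !adE br_linearl.
Qed.

HB.instance Definition _ := GRing.isLinear.Build F g 'End(g) _ ad ad_linear.

Lemma killingC x y : killing x y = killing y x.
Proof.
have B : basis_of {:g} stdb := vbasisP _.
by rewrite /killing !(mxof_comp _ _ B) mxtrace_mulC.
Qed.

Lemma killing_linearl y : linear (fun x => killing x y : F^o).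
Proof.
move=> a x z; rewrite /killing ad_linear comp_lfunDl -comp_lfunZl.
by rewrite linearD linearZ /= mxtraceD mxtraceZ.
Qed.

Lemma killing_suml n (c : 'I_n -> F) (f : 'I_n -> g) y :
  killing (\sum_i c i *: f i) y = \sum_i c i * killing (f i) y.
Proof.
pose ky := GRing.isLinear.Build F g F^o _ _ (killing_linearl y).
pose kyL : {linear g -> F^o} := HB.pack (fun x => killing x y : F^o) ky.
rewrite -[LHS]/(kyL _) linear_sum /=.
by apply: eq_bigr => i _; rewrite -[LHS]/(kyL _) linearZ.
Qed.

Lemma killing_mxE x y :
  rVof stdb x *m killing_mx *m (rVof stdb y)^T = (killing x y)%:M.
Proof.
have E z : z = \sum_i rVof stdb z 0 i *: stdb`_i.
  rewrite {1}(coord_vbasis (memvf z)).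
  by apply: eq_bigr => i _; rewrite coord_rVof.
apply/rowP => k; rewrite ord1 {k} !mxE /= mulr1n {2}(E x) killing_suml.
under eq_bigr do rewrite mxE mulr_suml.
rewrite exchange_big /=; apply: eq_bigr => i _.
rewrite {2}(E y) killingC killing_suml mulr_sumr; apply: eq_bigr => j _.
by rewrite !mxE (killingC stdb`_j) -!mulrA; congr (_ * _); exact: mulrC.
Qed.

Lemma tpair_tens a b c d :
  tpair (tens a b) (tens c d) = killing a c * killing b d.
Proof.
rewrite /tpair /tens trmx_mul trmxK -!mulmxA mxtrace_mulC.
rewrite !mulmxA killing_mxE -!mulmxA (mulmxA (rVof _ d)) killing_mxE.
by rewrite -scalar_mxM mxtrace_scalar mulr1n (killingC d).
Qed.

End LieAlgebra.

Section Roots.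
Variables (R : realType) (g : lieAlg R[i]) (h : {vspace g}).

(* Cartan subalgebras of a complex semisimple Lie algebra: self-centralizing
   commutative subalgebras consisting of ad-diagonalizable elements. *)
Definition cartan :=
  [/\ forall x y, x \in h -> y \in h -> br x y = 0,
      forall x, (forall y, y \in h -> br y x = 0) -> x \in h
    & forall y, y \in h -> exists2 e : seq g, basis_of fullv e &
        forall v, v \in e -> exists c : R[i], br y v = c *: v].

Local Notation dual := 'Hom(subvs_of h, R[i]^o).

Definition dual_app (a : dual) (x : g) : R[i] := a (vsproj h x).

Definition rootspace (a : dual) : {vspace g} :=
  (\bigcap_(i < \dim h)
     lker (ad (vbasis h)`_i - dual_app a (vbasis h)`_i *: \1%VF))%VS.

Lemma mem_rootspace a x :
  reflect (forall y, y \in h -> br y x = dual_app a y *: x) (x \in rootspace a).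
Proof.
have lk y : (x \in lker (ad y - dual_app a y *: \1%VF)) =
            (br y x == dual_app a y *: x).
  by rewrite memv_ker add_lfunE opp_lfunE scale_lfunE id_lfunE adE subr_eq0.
apply: (iffP idP) => [xr y yh | xr]; last first.
  rewrite memvE; apply/subv_bigcapP => i _.
  by rewrite -memvE lk; apply/eqP/xr/vbasis_mem/mem_nth; rewrite size_tuple.
have /subv_bigcapP xb : (<[x]> <= rootspace a)%VS by rewrite -memvE.
rewrite -adE /dual_app (coord_vbasis yh) !linear_sum sum_lfunE scaler_suml.
apply: eq_bigr => i _; rewrite !linearZ /= scale_lfunE adE -scalerA.
by congr (_ *: _); apply/eqP; rewrite -lk memvE xb.
Qed.

Definition is_root (a : dual) := a <> 0 /\ rootspace a <> 0%VS.

Definition is_base (D : seq dual) r (P : r.-tuple dual) :=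
  [/\ {subset P <= D}, basis_of fullv P
    & forall a, a \in D ->
        exists c : 'I_r -> nat,
          a = \sum_i (c i)%:R *: P`_i \/ a = - \sum_i (c i)%:R *: P`_i].

(* H = 2 t_a / kappa(t_a, t_a), where t_a in h represents a under kappa. *)
Definition is_coroot (a : dual) (H : g) :=
  exists2 t : g, t \in h /\ (forall y, y \in h -> killing t y = dual_app a y)
    & H = (2 / killing t t) *: t.

End Roots.

(* The standard maximal parabolic subalgebra q of the simple root of index
   [simple_q], together with the choices of h and Pi it depends on. *)
Record maxParabolic (R : realType) (g : lieAlg R[i]) := MaxParabolic {
  csa : {vspace g};
  csaP : cartan csa;
  roots : seq 'Hom(subvs_of csa, R[i]^o);
  roots_uniq : uniq roots;
  rootsP : forall a, a \in roots <-> is_root a;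
  rank : nat;
  simples : rank.-tuple 'Hom(subvs_of csa, R[i]^o);
  simplesP : is_base roots simples;
  simple_q : 'I_rank
}.

Section Parabolic.
Variables (R : realType) (g : lieAlg R[i]) (p : maxParabolic g).
Local Notation h := (csa p).
Local Notation dual := 'Hom(subvs_of h, R[i]^o).

Definition pos_root (a : dual) := [forall i, 0 <= coord (simples p) i a].

Definition levi_root (a : dual) :=
  a \in <<[seq tnth (simples p) i | i <- enum 'I_(rank p) & i != simple_q p]>>%VS.

Definition levi : {vspace g} :=
  (h + \sum_(a <- roots p | levi_root a) rootspace a)%VS.

Definition nilrad : {vspace g} :=
  (\sum_(a <- roots p | pos_root a && ~~ levi_root a) rootspace a)%VS.

Definition par : {vspace g} := (levi + nilrad)%VS.

Definition quasi_heisenberg :=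
  brv nilrad (brv nilrad nilrad) = 0%VS /\ (1 < \dim (brv nilrad nilrad))%N.

Definition gr (j : int) : {vspace g} :=
  ((if j == 0%R then h else 0) +
   \sum_(a <- roots p | coord (simples p) (simple_q p) a == (j%:~R)%R)
     rootspace a)%VS.

Definition nilbar : {vspace g} := (gr (-1) + gr (-2))%VS.

Definition is_fund_weight (lam : dual) :=
  forall (i : 'I_(rank p)) H, is_coroot (simples p)`_i H ->
    dual_app lam H = (i == simple_q p)%:R.

(* The differential of the character of L with weight lam, extended by zero
   on n: it is lam on h and zero on the root spaces. *)
Definition dchar (lam : dual) (x : g) : R[i] :=
  dual_app lam (daddv_pi h (\sum_(a <- roots p) rootspace a)%VS x).

Definition par_part (x : g) : g := daddv_pi par nilbar x.
Definition nilbar_part (x : g) : g := daddv_pi nilbar par x.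

Definition is_omega (w : tens2 g) :=
  exists k (X Xs : k.-tuple g),
    [/\ basis_of (gr 2) X, basis_of (gr (-2)) Xs,
        forall i j : 'I_k, killing Xs`_i X`_j = (i == j)%:R
      & w = \sum_(i < k) tens Xs`_i X`_i].

Definition tau1 (w : tens2 g) (x : g) : tens2 g := adl x w.

(* z in g(-1) is tau1~(Y), the dual of g(1) being g(-1) via kappa. *)
Definition is_ttau1 (w Y : tens2 g) (z : g) :=
  z \in gr (-1) /\ forall x, x \in gr 1 -> killing z x = tpair Y (tau1 w x).

(* As L is connected, its submodules are those of its Lie algebra. *)
Definition levi_stable (V : {vspace tens2 g}) :=
  forall x T, x \in levi -> T \in V -> adl x T + adr x T \in V.

Definition irreducible_constituent (V : {vspace tens2 g}) :=
  [/\ (V <= tensv (gr 1) (gr (-2)))%VS, levi_stable V, V <> 0%VS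
    & forall W : {vspace tens2 g}, (W <= V)%VS -> levi_stable W ->
        W = 0%VS \/ W = V].

Definition special_constituent (w : tens2 g) (V : {vspace tens2 g}) :=
  irreducible_constituent V /\
  exists Y x, [/\ Y \in V, x \in gr 1 & tpair Y (tau1 w x) <> 0].

End Parabolic.

Section RealForms.
Variables (R : realType) (g : lieAlg R[i]).

(* S is a real subspace of U with U = S (+) iS. *)
Definition real_form_of (S : set g) (U : {vspace g}) :=
  [/\ forall x, S x -> x \in U, S 0,
      forall (c : R) x y, S x -> S y -> S (c%:C *: x + y),
      forall x, x \in U -> exists a b, [/\ S a, S b & x = a + 'i *: b]
    & forall a, S a -> S ('i *: a) -> a = 0].

Definition real_form_lie (S : set g) :=
  real_form_of S fullv /\ forall x y, S x -> S y -> S (br x y).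

Definition real_points (S : set g) (U : {vspace g}) : set g :=
  fun x => S x /\ x \in U.

Definition real_basis (S : set g) d (e : d.-tuple g) :=
  (forall i : 'I_d, S e`_i) /\
  forall x, S x -> exists! c : 'rV[R]_d, x = \sum_(i < d) (c 0 i)%:C *: e`_i.

End RealForms.

Section Smooth.
Variables (R : realType) (d : nat).
Local Notation fn := ('rV[R]_d -> R[i]).
Local Notation "''e_' i" := (delta_mx 0 i : 'rV[R]_d) (at level 8, i at level 2).

Fixpoint Ck (k : nat) (u : 'rV[R]_d -> R) : Prop :=
  continuous u /\
  if k is k'.+1 then
    forall i, (forall x, derivable u x 'e_i) /\ Ck k' (fun x => 'D_('e_i) u x)
  else True.

Definition smooth (f : fn) :=
  forall k, Ck k (fun x => complex.Re (f x)) /\ Ck k (fun x => complex.Im (f x)).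

Definition partial (i : 'I_d) (f : fn) : fn := fun x =>
  'D_('e_i) (fun y => complex.Re (f y)) x +i*
  'D_('e_i) (fun y => complex.Im (f y)) x.

(* An operator is a map on all functions, but only its values on smooth
   functions are ever constrained. *)
Definition is_diffop (D : fn -> fn) :=
  exists n (a : 'I_n -> fn) (I : 'I_n -> seq 'I_d),
    (forall k, smooth (a k)) /\
    forall f, smooth f -> forall x,
      D f x = \sum_k a k x * foldr partial f (I k) x.

Definition mx_smooth m (A : 'rV[R]_d -> 'M[R[i]]_m) :=
  forall i j, smooth (fun x => A x i j).

Definition equivalent_lists m (D D' : 'I_m -> fn -> fn) :=
  exists A B : 'rV[R]_d -> 'M[R[i]]_m,
    [/\ mx_smooth A, mx_smooth B, forall x, A x *m B x = 1%:M
      & forall i f, smooth f -> forall x,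
          D' i f x = \sum_j A x j i * D j f x].

Definition lin_indep_at m (D : 'I_m -> fn -> fn) (x : 'rV[R]_d) :=
  forall c : 'I_m -> R[i],
    (forall f, smooth f -> \sum_i c i * D i f x = 0) -> forall i, c i = 0.

End Smooth.

(* The group Nbar_0 is simply connected and nilpotent, hence diffeomorphic to
   its Lie algebra under exp.  Given a real basis e of that Lie algebra,
   x : 'rV[R]_d stands for the group element exp (pt e x). *)
Section Bundle.
Variables (R : realType) (g : lieAlg R[i]) (p : maxParabolic g).
Variables (d : nat) (e : d.-tuple g).
Local Notation fn := ('rV[R]_d -> R[i]).

Definition pt (x : 'rV[R]_d) : g := \sum_(i < d) (x 0 i)%:C *: e`_i.

Definition crd (X : g) : 'rV[R]_d := \row_i complex.Re (coord e i X).

(* exp X exp Y = exp (X + Y + [X, Y] / 2), as nbar is two-step nilpotent. *)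
Definition nmul (x y : 'rV[R]_d) : 'rV[R]_d :=
  crd (pt x + pt y + 2^-1 *: br (pt x) (pt y)).

(* R(e_i): right differentiation along exp (t e_i) *)
Definition Rbasis (i : 'I_d) (f : fn) : fn := fun x =>
  let c t := f (nmul x (t *: delta_mx 0 i)) in
  derive1 (fun t => complex.Re (c t)) 0 +i* derive1 (fun t => complex.Im (c t)) 0.

(* Complex-linear extension to nbar: e is also a complex basis of nbar. *)
Definition Rdiff (X : g) (f : fn) : fn := fun x =>
  \sum_(i < d) coord e i X * Rbasis i f x.

(* Ad (exp X) = exp (ad X) for X in nbar; ad X lowers degrees by at
   least 1 and the degrees of g lie between -2 and 2, so that (ad X)^5 = 0. *)
Definition Ad_exp (X Y : g) : g :=
  \sum_(k < 5) (k`!%:R)^-1 *: iter k (br X) Y.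

(* (exp (pt x))^-1 = exp (- pt x) *)
Definition pi_s (lam : 'Hom(subvs_of (csa p), R[i]^o)) (s : R[i]) (Y : g)
    (f : fn) : fn := fun x =>
  let Z := Ad_exp (- pt x) Y in
  s * dchar lam (par_part p Z) * f x - Rdiff (nilbar_part p Z) f x.

Definition conformally_invariant lam s m (D : 'I_m -> fn -> fn) :=
  [/\ forall i, is_diffop (D i), forall x, lin_indep_at D x
    & forall X : g, exists C : 'rV[R]_d -> 'M[R[i]]_m, mx_smooth C /\
        forall i f, smooth f -> forall x,
          pi_s lam s X (D i f) x - D i (pi_s lam s X f) x =
          \sum_j C x j i * D j f x].

Definition Omega1_system m (D : 'I_m -> fn -> fn) :=
  exists w V (Y : m.-tuple (tens2 g)) (Z : m.-tuple g),
    [/\ is_omega p w, special_constituent p w V, basis_of V Y,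
        forall i : 'I_m, is_ttau1 p w Y`_i Z`_i
      & equivalent_lists (fun i => Rdiff Z`_i) D].

End Bundle.

(* Main.v *)
(** A section of the bundle transforms under X through Y = Ad(n^-1) X, and for Z
    in g(-1) the commutator of pi_s(X) and R(Z) is s lam([Z, Y_1]) - R([Z, Y_0]),
    where Y_j is the component of Y in g(j).  For s = 0 the right-hand side is a
    combination of the R(Z_j) because g(-1) is stable under g(0).  Conversely,
    applied to the constant function 1 at the identity, conformal invariance gives
    s lam([Z, X]) = 0 for all Z in g(-1) and X in g(1), and [Z, X] can be chosen to
    be a nonzero multiple of the coroot of alpha_q, on which lam does not vanish.

    The facts needed about the grading (g(-1) is irreducible under g(0), n is
    generated by g(1), hence g(j) = 0 for |j| > 2) all follow from one trace
    argument, [commuting_eq0], which needs neither sl2-theory nor Cartan's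
    criterion: the Killing form is nonzero because the dual bases entering omega
    exist, and so it is nondegenerate by simplicity. *)
From HB Require Import structures.
Require Import Defs.
From mathcomp Require Import all_boot all_order all_algebra complex.
From mathcomp Require Import all_classical all_reals all_analysis.
From mathcomp Require Import zify ring lra.

Set Implicit Arguments.
Unset Strict Implicit.
Unset Printing Implicit Defensive.

Import Order.TTheory GRing.Theory Num.Theory.
Import numFieldNormedType.Exports.
Import passmx.

Local Open Scope ring_scope.

(** * Directional and second derivatives on row vectors *)

Section PartialDerivatives.
Local Open Scope classical_set_scope.
Variables (R : realType) (d : nat).
Implicit Types (u : 'rV[R]_d -> R) (x y v w : 'rV[R]_d).

(** In exponential coordinates x on the two-step nilpotent group, R(Z) is the vector field with
    velocity Z + [x, Z] / 2, so the commutators to be computed are brackets of vector fields with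
    smooth coefficients. [Ck] only speaks of iterated partial derivatives and their continuity;
    derivatives along arbitrary lines and the symmetry of second partials are derived from that. The
    list D is known only up to an invertible smooth matrix A, so commutators also differentiate A;
    these terms are again combinations of the R(Z_j). On the algebraic side [quasi_heisenberg]
    bounds brackets in n, whereas truncating [Ad_exp] after five terms, multiplying by [nmul] and
    splitting g into [nilbar] and [par] rest on g(j) = 0 for |j| > 2. Maximality of q enters through
    the centre of g(0), which is the line spanned by the grading element E; this confines the
    element representing the trace functional to a single line. *)

Lemma is_derive_line u y v (t : R) : (forall z, derivable u z v) ->
  is_derive t 1 (fun t : R => u (y + t *: v)) ('D_v u (y + t *: v)).
Proof.
move=> uv; have := uv (y + t *: v); rewrite /derivable => du.
have E : (fun h : R => h^-1 *: (((fun t : R => u (y + t *: v)) \o shift t) (h *: 1) -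
      u (y + t *: v)))
  = (fun h : R => h^-1 *: ((u \o shift (y + t *: v)) (h *: v) - u (y + t *: v))).
  apply/funext => h /=; congr (_ *: (u _ - _)).
  by rewrite [h *: 1]mulr1 scalerDl addrCA.
by split; rewrite /derivable /derive E.
Qed.

Lemma mean_value_line u y v (h : R) : (forall z, derivable u z v) ->
  exists2 c : R, `|c| <= `|h| & u (y + h *: v) - u y = h * 'D_v u (y + c *: v).
Proof.
move=> uv.
have dl t := @is_derive_line u y v t uv.
have cl (A : set R) : {within A, continuous (fun t : R => u (y + t *: v))}.
  apply: continuous_subspaceT => t.
  apply: differentiable_continuous; apply/derivable1_diffP.
  by case: (dl t).
have [h0|h0|->] := ltgtP h 0.
- have [c /itvP ch] := MVT h0 (fun t _ => dl t) (cl _).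
  rewrite scale0r addr0 sub0r mulrN => E; exists c.
    by rewrite !ler0_norm ?lerN2 ?ch// ltW.
  by rewrite -opprB E opprK mulrC.
- have [c /itvP ch] := MVT h0 (fun t _ => dl t) (cl _).
  rewrite scale0r addr0 subr0 => E; exists c.
    by rewrite !ger0_norm ?ch// ltW.
  by rewrite E mulrC.
- by exists 0; rewrite // scale0r addr0 subrr mul0r.
Qed.

(** The base point y + t w moves with t as well, so differentiability at y alone does not suffice.
    The mean value theorem turns the quotient into c times D_v u at a point within O(t) of y, and
    continuity of D_v u concludes. *)
Lemma cvg_increment u y v w (c : R) : (forall z, derivable u z v) ->
  continuous ('D_v u) ->
  (fun t : R => t^-1 * (u (y + t *: w + (t * c) *: v) - u (y + t *: w))) @ 0^'
    --> c * 'D_v u y.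
Proof.
move=> uv cD.
apply/cvgrPdist_lt => /= eps eps0.
(* Adding 1 keeps the divisor positive when c = 0. *)
pose K := `|c| + 1.
have K0 : 0 < K by rewrite ltr_wpDl.
have := cD y => /cvgrPdist_lt /(_ (eps / K) (divr_gt0 eps0 K0)).
rewrite near_nbhs => /nbhs_ballP [del /= del0 near_y].
pose M := `|w| + K * `|v| + 1.
have M0 : 0 < M by rewrite ltr_wpDl// addr_ge0// mulr_ge0// ltW.
near=> t.
have tn0 : t != 0 by near: t; exact: nbhs_dnbhs_neq.
have [th thle ->] := mean_value_line (y + t *: w) (t * c) uv.
rewrite !mulrA mulVf// mul1r -mulrBr normrM.
have : `|'D_v u y - 'D_v u (y + t *: w + th *: v)| < eps / K.
  apply: near_y; rewrite -ball_normE /=.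
  rewrite -!addrA opprD addNKr normrN.
  have thle' : `|th| <= `|t| * K.
    by apply: (le_trans thle); rewrite normrM ler_wpM2l// lerDl.
  apply: (@le_lt_trans _ _ (`|t| * (`|w| + K * `|v|))).
    rewrite (le_trans (ler_normD _ _))// mulrDr !normrZ lerD// mulrA.
    by rewrite ler_wpM2r.
  apply: (@le_lt_trans _ _ (`|t| * M)); first by rewrite ler_wpM2l// lerDl.
  rewrite -ltr_pdivlMr//.
  by near: t; apply: dnbhs0_lt; exact: divr_gt0.
rewrite ltr_pdivlMr// mulrC => /le_lt_trans; apply.
by rewrite ler_wpM2r// lerDl.
Unshelve. all: by end_near.
Qed.

Local Notation "''e_' i" := (delta_mx 0 i : 'rV[R]_d) (at level 8, i at level 2).

(** The increment along v is made one coordinate at a time: each step changes a single coordinate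
    from a base point that already moves with t, which is the situation of [cvg_increment]. *)
Lemma is_derive_rV u x v :
  (forall i y, derivable u y 'e_i) -> (forall i, continuous ('D_('e_i) u)) ->
  is_derive x v u (\sum_i v 0 i * 'D_('e_i) u x).
Proof.
move=> ud uc.
suff H (s : seq 'I_d) :
    (fun t : R => t^-1 * (u (x + t *: \sum_(i <- s) v 0 i *: 'e_i) - u x)) @ 0^'
     --> \sum_(i <- s) v 0 i * 'D_('e_i) u x.
  have := H (index_enum _); rewrite -row_sum_delta => Hv.
  have E : (fun h : R => h^-1 *: ((u \o shift x) (h *: v) - u x)) =
           (fun t : R => t^-1 * (u (x + t *: v) - u x)).
    by apply/funext => t /=; rewrite (addrC x).
  have dv : derivable u x v by rewrite /derivable E; apply/cvg_ex; eexists; exact: Hv.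
  by apply: (DeriveDef dv); rewrite /derive E; apply: cvg_lim.
elim: s => [|i s IH].
  rewrite !big_nil; apply: (@cvg_trans _ ((fun=> 0 : R) @ (0 : R)^')); last exact: cvg_cst.
  by apply: near_eq_cvg; near=> t; rewrite scaler0 addr0 subrr mulr0.
rewrite !big_cons; set w := \sum_(j <- s) _ in IH *.
have H := cvgD (@cvg_increment u x ('e_i) w (v 0 i) (ud i) (uc i)) IH.
have {}H := H ltac:(typeclasses eauto).
apply: (cvg_trans _ H); apply: near_eq_cvg; near=> t.
rewrite /= -mulrDr; congr (_ * _).
rewrite -[LHS]/(_ - u (x + t *: w) + (u (x + t *: w) - u x)).
by rewrite subrKA scalerDr scalerA -addrA (addrC (t *: w)).
Unshelve. all: by end_near.
Qed.

(** Mean value theorem twice: along w for y |-> u(y + h v) - u(y), then along v for the derivative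
    [du] in the direction w. *)
Lemma second_difference u (du : 'rV[R]_d -> R) x v w (h : R) :
  (forall y, is_derive y w u (du y)) -> (forall y, derivable du y v) ->
  exists a b : R, [/\ `|a| <= `|h|, `|b| <= `|h| &
    u (x + h *: v + h *: w) - u (x + h *: v) - u (x + h *: w) + u x
    = h * (h * 'D_v du (x + a *: v + b *: w))].
Proof.
move=> Hu Hdu.
pose g y : R := u (y + h *: v) - u y.
have dg y : is_derive y w g (du (y + h *: v) - du y).
  apply: is_deriveB.
  have E : (fun t : R => t^-1 *: (((fun y => u (y + h *: v)) \o shift y) (t *: w) - u (y + h *: v)))
    = (fun t : R => t^-1 *: ((u \o shift (y + h *: v)) (t *: w) - u (y + h *: v))).
    by apply/funext => t /=; rewrite addrA.
  have [d1 d2] := Hu (y + h *: v).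
  by split; [move: d1; rewrite /derivable E|move: d2; rewrite /derive E].
have dge z : derivable g z w by case: (dg z).
have [b bh] := mean_value_line x h dge.
rewrite (@derive_val _ _ _ _ _ _ _ (dg _)) => Eb.
have [a ah Ea] := mean_value_line (x + b *: w) h Hdu.
exists a, b; split => //.
rewrite (addrAC x (a *: v)) -Ea -Eb /g (addrAC x (h *: w)).
set A := u _; set B := u (x + _); set C := u (x + _); set D := u x.
by ring.
Qed.

(** The second difference over the parallelogram with sides h v and h w is symmetric in v and w.
    [second_difference] evaluates it in both orders as h^2 times a mixed derivative near x, and
    continuity at x lets h tend to 0. *)
Lemma is_derive_swap u (uv uw uvw uwv : 'rV[R]_d -> R) v w x :
  (forall y, is_derive y v u (uv y)) -> (forall y, is_derive y w u (uw y)) ->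
  (forall y, is_derive y w uv (uvw y)) -> (forall y, is_derive y v uw (uwv y)) ->
  {for x, continuous uvw} -> {for x, continuous uwv} -> uvw x = uwv x.
Proof.
move=> Hv Hw Hvw Hwv cvw cwv.
have key (h : R) : h != 0 -> exists a b a' b' : R,
   [/\ `|a| <= `|h| /\ `|b| <= `|h|, `|a'| <= `|h| /\ `|b'| <= `|h| &
    uvw (x + a *: w + b *: v) = uwv (x + a' *: v + b' *: w)].
  move=> h0.
  have dvw z : derivable uv z w by case: (Hvw z).
  have dwv z : derivable uw z v by case: (Hwv z).
  have [a [b [ha hb E]]] := second_difference x h Hv dvw.
  have [a' [b' [ha' hb' E']]] := second_difference x h Hw dwv.
  exists a, b, a', b'; split; [by split|by split|].
  rewrite (@derive_val _ _ _ _ _ _ _ (Hvw _)) in E.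
  rewrite (@derive_val _ _ _ _ _ _ _ (Hwv _)) in E'.
  apply: (mulfI h0); apply: (mulfI h0); rewrite -E -E'.
  rewrite (addrAC x (h *: w)).
  set A := u _; set B := u (x + _); set C := u (x + _); set D := u x.
  by ring.
have near_x (D : 'rV[R]_d -> R) v1 v2 e : {for x, continuous D} -> 0 < e ->
  exists2 r : R, 0 < r & forall a b : R,
    `|a| < r -> `|b| < r -> `|D x - D (x + a *: v1 + b *: v2)| < e.
  move=> cD e0; have := cD => /cvgrPdist_lt /(_ e e0).
  rewrite near_nbhs => /nbhs_ballP [del /= del0 near_y].
  pose M : R := `|v1| + `|v2| + 1.
  have M0 : 0 < M by rewrite ltr_wpDl// addr_ge0.
  exists (del / M); first exact: divr_gt0.
  move=> a b aM bM; apply: near_y; rewrite -ball_normE /= -!addrA opprD addNKr normrN.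
  rewrite (le_lt_trans (ler_normD _ _))// !normrZ.
  apply: (@le_lt_trans _ _ ((del / M) * (`|v1| + `|v2|))).
    by rewrite mulrDr lerD// ler_wpM2r// ltW.
  by rewrite mulrAC ltr_pdivrMr// ltr_pM2l// ltrDl.
apply/eqP; rewrite -subr_eq0 -normr_le0; apply/ler_addgt0Pl => e e0; rewrite addr0.
have e2 : 0 < e / 2 by rewrite divr_gt0.
have [r1 r10 H1] := near_x _ w v _ cvw e2; have [r2 r20 H2] := near_x _ v w _ cwv e2.
pose h := Num.min r1 r2 / 2.
have r0 : 0 < Num.min r1 r2 by rewrite lt_min r10.
have h0 : 0 < h by rewrite divr_gt0.
have hr : h < Num.min r1 r2 by rewrite /h; lra.
move: hr; rewrite lt_min => /andP[hr1 hr2].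
have [a [b [a' [b' [[ha hb] [ha' hb'] E]]]]] := key h (lt0r_neq0 h0).
rewrite (ger0_norm (ltW h0)) in ha hb ha' hb'.
have := H1 a b (le_lt_trans ha hr1) (le_lt_trans hb hr1).
have := H2 a' b' (le_lt_trans ha' hr2) (le_lt_trans hb' hr2).
rewrite E => H3 H4.
rewrite (le_trans (ler_distD (uwv (x + a' *: v + b' *: w)) _ _))//.
by rewrite [leRHS]splitr lerD ?ltW// distrC.
Qed.

Lemma partialC u i j x : Ck 2 u ->
  'D_('e_i) (fun y => 'D_('e_j) u y) x = 'D_('e_j) (fun y => 'D_('e_i) u y) x.
Proof.
move=> [_ C1].
have C k y : is_derive y 'e_k u ('D_('e_k) u y).
  by apply: derivableP; case: (C1 k).
have C' k l y : is_derive y 'e_l (fun y => 'D_('e_k) u y) ('D_('e_l) (fun y => 'D_('e_k) u y) y).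
  by apply: derivableP; case: (C1 k) => _ [_ /(_ l)[]].
have cD k l : continuous (fun y => 'D_('e_l) (fun y => 'D_('e_k) u y) y).
  by case: (C1 k) => _ [_ /(_ l)[_ []]].
apply: (is_derive_swap (C j) (C i) (C' j i) (C' i j)); exact: cD.
Qed.

End PartialDerivatives.

(** * Smooth functions and vector fields *)

Section SmoothCalculus.
Local Open Scope classical_set_scope.
Local Open Scope complex_scope.
Variables (R : realType) (d : nat).
Local Notation "''e_' i" := (delta_mx 0 i : 'rV[R]_d) (at level 8, i at level 2).
Local Notation fn := ('rV[R]_d -> R[i]).
Implicit Types (u v : 'rV[R]_d -> R) (f g : fn) (c : 'I_d -> fn).

Lemma CkW k u : Ck k.+1 u -> Ck k u.
Proof.
elim: k u => [|k IH] u [uc H]; split => // i.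
by have [H1 H2] := H i; split => //; apply: IH.
Qed.

Lemma Ck_cst k (a : R) : Ck k (fun _ : 'rV[R]_d => a).
Proof.
elim: k a => [|k IH] a; split => //; try exact: cst_continuous.
move=> i; split; first by move=> x; exact: derivable_cst.
have -> : (fun x => 'D_('e_i) (fun _ : 'rV[R]_d => a) x) = fun=> 0.
  by apply/funext => x; exact: derive_cst.
exact: IH.
Qed.

Lemma CkD k u v : Ck k u -> Ck k v -> Ck k (fun x => u x + v x).
Proof.
elim: k u v => [|k IH] u v [uc H] [vc H'];
  have C : continuous (fun x => u x + v x)
    by move=> x; apply: continuousD; [exact: uc|exact: vc].
  by split.
split=> // i; have [du Du] := H i; have [dv Dv] := H' i; split.
  by move=> x; apply: derivableD.
have -> : (fun x => 'D_('e_i) (fun x => u x + v x) x) =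
          fun x => 'D_('e_i) u x + 'D_('e_i) v x.
  by apply/funext => x; apply: deriveD.
exact: IH.
Qed.

Lemma CkM k u v : Ck k u -> Ck k v -> Ck k (fun x => u x * v x).
Proof.
elim: k u v => [|k IH] u v Cu Cv; have [uc H] := Cu; have [vc H'] := Cv;
  have C : continuous (fun x => u x * v x)
    by move=> x; apply: continuousM; [exact: uc|exact: vc].
  by split.
split=> // i; have [du Du] := H i; have [dv Dv] := H' i; split.
  by move=> x; apply: derivableM.
have -> : (fun x => 'D_('e_i) (fun x => u x * v x) x) =
          fun x => u x * 'D_('e_i) v x + v x * 'D_('e_i) u x.
  by apply/funext => x; apply: deriveM.
by apply: CkD; apply: IH => //; apply: CkW.
Qed.

Lemma CkN k u : Ck k u -> Ck k (fun x => - u x).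
Proof.
move=> Cu; have -> : (fun x => - u x) = (fun x => -1 * u x).
  by apply/funext => x; rewrite mulN1r.
exact: CkM (Ck_cst _ _) Cu.
Qed.

Lemma is_derive_coord i (x v : 'rV[R]_d) : is_derive x v (fun y : 'rV[R]_d => y 0 i) (v 0 i).
Proof.
have E : (fun h : R => h^-1 *: (((fun y : 'rV[R]_d => y 0 i) \o shift x) (h *: v) - x 0 i)) @ 0^'
    --> v 0 i.
  apply: (@cvg_trans _ ((fun=> v 0 i : R) @ (0 : R)^')); last exact: cvg_cst.
  apply: near_eq_cvg; near=> t.
  rewrite /= !mxE addrK.
  have t0 : t != 0 by near: t; exact: nbhs_dnbhs_neq.
  by rewrite -[RHS]/(t^-1 * (t * v 0 i)) mulKf.
have D : derivable (fun y : 'rV[R]_d => y 0 i) x v by apply/cvg_ex; eexists; exact: E.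
by apply: (DeriveDef D); rewrite /derive; apply: cvg_lim => //.
Unshelve. all: by end_near.
Qed.

Lemma Ck_coord k i : Ck k (fun x : 'rV[R]_d => x 0 i).
Proof.
have C : continuous (fun x : 'rV[R]_d => x 0 i) by exact: coord_continuous.
case: k => [|k]; split => // j; split=> [x|].
  by case: (is_derive_coord i x 'e_j).
have -> : (fun x => 'D_('e_j) (fun y : 'rV[R]_d => y 0 i) x) = fun=> ('e_j : 'rV[R]_d) 0 i.
  by apply/funext => x; exact: (@derive_val _ _ _ _ _ _ _ (is_derive_coord i x 'e_j)).
exact: Ck_cst.
Qed.

Lemma complex_ReD (a b : R[i]) : complex.Re (a + b) = complex.Re a + complex.Re b.
Proof. by case: a; case: b. Qed.
Lemma complex_ImD (a b : R[i]) : complex.Im (a + b) = complex.Im a + complex.Im b.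
Proof. by case: a; case: b. Qed.
Lemma complex_ReM (a b : R[i]) : complex.Re (a * b) =
  complex.Re a * complex.Re b - complex.Im a * complex.Im b.
Proof. by case: a; case: b. Qed.
Lemma complex_ImM (a b : R[i]) : complex.Im (a * b) =
  complex.Re a * complex.Im b + complex.Im a * complex.Re b.
Proof. by case: a; case: b. Qed.

Lemma smooth_cst (a : R[i]) : smooth (fun _ : 'rV[R]_d => a).
Proof. by move=> k; split; apply: Ck_cst. Qed.

Lemma smooth_coord i : smooth (fun x : 'rV[R]_d => (x 0 i)%:C).
Proof. by move=> k; split; [apply: Ck_coord|apply: Ck_cst]. Qed.

Lemma smoothD f g : smooth f -> smooth g -> smooth (fun x => f x + g x).
Proof.
move=> sf sg k; have [rf jf] := sf k; have [rg jg] := sg k.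
by split; [under eq_fun do rewrite complex_ReD|under eq_fun do rewrite complex_ImD]; apply: CkD.
Qed.

Lemma smoothM f g : smooth f -> smooth g -> smooth (fun x => f x * g x).
Proof.
move=> sf sg k; have [rf jf] := sf k; have [rg jg] := sg k.
split; [under eq_fun do rewrite complex_ReM|under eq_fun do rewrite complex_ImM]; apply: CkD;
  try apply: CkN; exact: CkM.
Qed.

Lemma smooth_sum (I : Type) (r : seq I) (F : I -> fn) :
  (forall i, smooth (F i)) -> smooth (fun x => \sum_(i <- r) F i x).
Proof.
move=> H; elim: r => [|i r IH].
  by under eq_fun do rewrite big_nil; exact: smooth_cst.
by under eq_fun do rewrite big_cons; exact: smoothD.
Qed.

Lemma smoothZ a f : smooth f -> smooth (fun x => a * f x).
Proof. exact/smoothM/smooth_cst. Qed.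

Lemma smoothN f : smooth f -> smooth (fun x => - f x).
Proof. by move=> sf; under eq_fun do rewrite -mulN1r; exact: smoothZ. Qed.

Lemma smoothB f g : smooth f -> smooth g -> smooth (fun x => f x - g x).
Proof. by move=> sf sg; apply: smoothD => //; exact: smoothN. Qed.

Lemma smooth_partial i f : smooth f -> smooth (partial i f).
Proof.
by move=> sf k; have [[_ /(_ i)[_ ?]] [_ /(_ i)[_ ?]]] := sf k.+1.
Qed.

Lemma smooth_derivable i f x : smooth f ->
  derivable (fun y => complex.Re (f y)) x 'e_i /\
  derivable (fun y => complex.Im (f y)) x 'e_i.
Proof. by move=> sf; have [[_ /(_ i)[? _]] [_ /(_ i)[? _]]] := sf 1%N. Qed.

Lemma partial_cst i a x : partial i (fun _ : 'rV[R]_d => a) x = 0.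
Proof. by rewrite /partial !derive_cst. Qed.

Lemma partial_coord i j x : partial i (fun x : 'rV[R]_d => (x 0 j)%:C) x = (j == i)%:R.
Proof.
rewrite /partial (@derive_val _ _ _ _ _ _ _ (is_derive_coord j x 'e_i)) derive_cst mxE eqxx.
by case: (j == i).
Qed.

Lemma partialD i f g x : smooth f -> smooth g ->
  partial i (fun x => f x + g x) x = partial i f x + partial i g x.
Proof.
move=> sf sg; have [? ?] := smooth_derivable i x sf; have [? ?] := smooth_derivable i x sg.
rewrite /partial; under eq_fun do rewrite complex_ReD.
under [X in _ +i* 'D_(_) X _]eq_fun do rewrite complex_ImD.
by rewrite !deriveD.
Qed.

Lemma partialM i f g x : smooth f -> smooth g ->
  partial i (fun x => f x * g x) x = f x * partial i g x + g x * partial i f x.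
Proof.
move=> sf sg; have [? ?] := smooth_derivable i x sf; have [? ?] := smooth_derivable i x sg.
rewrite /partial; under eq_fun do rewrite complex_ReM.
under [X in _ +i* 'D_(_) X _]eq_fun do rewrite complex_ImM.
have keyB (a a' b b' : 'rV[R]_d -> R) : derivable a x 'e_i -> derivable a' x 'e_i ->
    derivable b x 'e_i -> derivable b' x 'e_i ->
    'D_('e_i) (fun y => a y * a' y - b y * b' y) x =
    (a x * 'D_('e_i) a' x + a' x * 'D_('e_i) a x) - (b x * 'D_('e_i) b' x + b' x * 'D_('e_i) b x).
  move=> da da' db db'; rewrite -(deriveM da da') -(deriveM db db').
  exact: deriveB (derivableM da da') (derivableM db db').
have keyD (a a' b b' : 'rV[R]_d -> R) : derivable a x 'e_i -> derivable a' x 'e_i ->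
    derivable b x 'e_i -> derivable b' x 'e_i ->
    'D_('e_i) (fun y => a y * a' y + b y * b' y) x =
    (a x * 'D_('e_i) a' x + a' x * 'D_('e_i) a x) + (b x * 'D_('e_i) b' x + b' x * 'D_('e_i) b x).
  move=> da da' db db'; rewrite -(deriveM da da') -(deriveM db db').
  exact: deriveD (derivableM da da') (derivableM db db').
rewrite keyB// keyD//.
apply/eqP; rewrite eq_complex /= complex_ReD complex_ImD !complex_ReM !complex_ImM /=.
by apply/andP; split; apply/eqP; ring.
Qed.

Lemma partial_swap i j f x : smooth f ->
  partial i (partial j f) x = partial j (partial i f) x.
Proof.
move=> sf; have [C1 C2] := sf 2%N.
exact: (congr2 (@Complex R) (partialC i j x C1) (partialC i j x C2)).
Qed.

Definition vfield c f : fn := fun x => \sum_k c k x * partial k f x.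

Lemma smooth_vfield c f : (forall k, smooth (c k)) -> smooth f -> smooth (vfield c f).
Proof.
move=> sc sf; apply: smooth_sum => k; apply: smoothM => //; exact: smooth_partial.
Qed.

Lemma vfield_cst c a x : vfield c (fun=> a) x = 0.
Proof. by rewrite /vfield big1// => k _; rewrite partial_cst mulr0. Qed.

(** Evaluation on coordinate functions recovers the coefficients of a vector field; pointwise
    independence of the operators is tested this way. *)
Lemma vfield_coord c j x : vfield c (fun x : 'rV[R]_d => (x 0 j)%:C) x = c j x.
Proof.
rewrite /vfield (bigD1 j)//= partial_coord eqxx mulr1 big1 ?addr0// => k kj.
by rewrite partial_coord eq_sym (negPf kj) mulr0.
Qed.

Lemma vfieldD c f g x : smooth f -> smooth g ->
  vfield c (fun x => f x + g x) x = vfield c f x + vfield c g x.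
Proof.
move=> sf sg; rewrite /vfield -big_split /=; apply: eq_bigr => k _.
by rewrite partialD// mulrDr.
Qed.

Lemma vfieldM c f g x : smooth f -> smooth g ->
  vfield c (fun x => f x * g x) x = f x * vfield c g x + g x * vfield c f x.
Proof.
move=> sf sg; rewrite /vfield !mulr_sumr -big_split /=; apply: eq_bigr => k _.
rewrite partialM//; ring.
Qed.

Lemma vfieldZ c a f x : smooth f -> vfield c (fun x => a * f x) x = a * vfield c f x.
Proof.
by move=> sf; rewrite vfieldM//; [rewrite vfield_cst mulr0 addr0|exact: smooth_cst].
Qed.

Lemma vfieldN c f x : smooth f -> vfield c (fun x => - f x) x = - vfield c f x.
Proof.
by move=> sf; under eq_fun do rewrite -mulN1r; rewrite vfieldZ// mulN1r.
Qed.

Lemma vfield_sum c (I : Type) (r : seq I) (F : I -> fn) x :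
  (forall i, smooth (F i)) ->
  vfield c (fun x => \sum_(i <- r) F i x) x = \sum_(i <- r) vfield c (F i) x.
Proof.
move=> H; elim: r => [|i r IH].
  by under eq_fun do rewrite big_nil; rewrite big_nil vfield_cst.
under eq_fun do rewrite big_cons; rewrite big_cons vfieldD ?IH//.
exact: smooth_sum.
Qed.

(** The second-order parts of the two compositions agree by symmetry of the partials and cancel,
    leaving a vector field. *)
Lemma vfield_bracket c c' f x :
  (forall k, smooth (c k)) -> (forall k, smooth (c' k)) -> smooth f ->
  vfield c (vfield c' f) x - vfield c' (vfield c f) x =
  \sum_k (vfield c (c' k) x - vfield c' (c k) x) * partial k f x.
Proof.
move=> sc sc' sf.
have E a b : (forall k, smooth (a k)) -> (forall k, smooth (b k)) ->
  vfield a (vfield b f) x = \sum_k vfield a (b k) x * partial k f x +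
     \sum_k \sum_l a l x * b k x * partial l (partial k f) x.
  move=> sa sb; rewrite vfield_sum; last first.
    by move=> k; apply: smoothM => //; exact: smooth_partial.
  rewrite -big_split; apply: eq_bigr => k _.
  rewrite vfieldM//; last exact: smooth_partial.
  rewrite addrC mulrC; congr (_ + _); rewrite /vfield mulr_sumr.
  by apply: eq_bigr => l _; rewrite mulrCA mulrA.
rewrite !E// opprD addrACA [X in _ + (_ - X)]exchange_big /=.
rewrite [X in _ + X](_ : _ = 0) ?addr0; last first.
  apply/eqP; rewrite subr_eq0; apply/eqP; apply: eq_bigr => k _; apply: eq_bigr => l _.
  by rewrite partial_swap// [a in a * _]mulrC.
by rewrite -sumrB; apply: eq_bigr => k _; rewrite mulrBl.
Qed.

Lemma derive1_line u (x v : 'rV[R]_d) : Ck 1 u ->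
  derive1 (fun t : R => u (x + t *: v)) 0 = \sum_k v 0 k * 'D_('e_k) u x.
Proof.
move=> [_ C1].
have D y : is_derive y v u (\sum_k v 0 k * 'D_('e_k) u y).
  by apply: is_derive_rV => k; case: (C1 k) => // _ [].
have dl := @is_derive_line _ _ u x v 0 (fun z => @ex_derive _ _ _ _ _ _ _ (D z)).
rewrite derive1E (@derive_val _ _ _ _ _ _ _ dl) scale0r addr0.
exact: (@derive_val _ _ _ _ _ _ _ (D _)).
Qed.

Lemma derive1_complex_line f (x v : 'rV[R]_d) : smooth f ->
  derive1 (fun t : R => complex.Re (f (x + t *: v))) 0 +i*
  derive1 (fun t : R => complex.Im (f (x + t *: v))) 0
  = \sum_k (v 0 k)%:C * partial k f x.
Proof.
move=> sf; have [C1 C2] := sf 1%N.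
rewrite (derive1_line _ _ C1) (derive1_line _ _ C2).
apply/eqP; rewrite eq_complex /=.
rewrite (big_morph _ complex_ReD (erefl : complex.Re 0 = 0)).
rewrite (big_morph _ complex_ImD (erefl : complex.Im 0 = 0)).
by apply/andP; split; apply/eqP; apply: eq_bigr => k _;
  rewrite ?complex_ReM ?complex_ImM /= mul0r ?subr0 ?addr0.
Qed.

End SmoothCalculus.

(** * Lie algebras and the Killing form *)

Section LieBasics.
Variables (F : fieldType) (g : lieAlg F).
Implicit Types (x y z : g) (U V W : {vspace g}).
Local Notation stdb := (vbasis (fullv : {vspace g})).

Lemma brDr x y z : br x (y + z) = br x y + br x z.
Proof. by rewrite -!adE linearD. Qed.
Lemma brZr a x y : br x (a *: y) = a *: br x y.
Proof. by rewrite -!adE linearZ. Qed.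
Lemma brNr x y : br x (- y) = - br x y.
Proof. by rewrite -!adE linearN. Qed.
Lemma br0r x : br x 0 = 0.
Proof. by rewrite -!adE linear0. Qed.
Lemma br_sumr x (I : Type) (r : seq I) (P : pred I) (f : I -> g) :
  br x (\sum_(i <- r | P i) f i) = \sum_(i <- r | P i) br x (f i).
Proof. by rewrite -adE linear_sum; apply: eq_bigr => i _; rewrite /= adE. Qed.

Lemma brC x y : br x y = - br y x.
Proof.
apply/eqP; rewrite -addr_eq0; apply/eqP.
have := br_alt (x + y); rewrite brDr -!adE linearD /= !add_lfunE !adE.
by rewrite !br_alt addr0 add0r addrC.
Qed.

Lemma brDl x y z : br (x + y) z = br x z + br y z.
Proof. by rewrite -!adE linearD /= add_lfunE. Qed.
Lemma brZl a x y : br (a *: x) y = a *: br x y.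
Proof. by rewrite -!adE linearZ /= scale_lfunE. Qed.
Lemma brNl x y : br (- x) y = - br x y.
Proof. by rewrite brC brNr -brC. Qed.
Lemma br0l x : br 0 x = 0.
Proof. by rewrite brC br0r oppr0. Qed.
Lemma br_suml (I : Type) (r : seq I) (P : pred I) (f : I -> g) y :
  br (\sum_(i <- r | P i) f i) y = \sum_(i <- r | P i) br (f i) y.
Proof. by rewrite brC br_sumr -sumrN; apply: eq_bigr => i _; rewrite -brC. Qed.

Lemma br_brl x y z : br (br x y) z = br x (br y z) - br y (br x z).
Proof.
have := br_jacobi x y z; rewrite (brC z (br x y)) (brC z x) brNr => /eqP.
by rewrite subr_eq0 eq_sym => /eqP.
Qed.

Lemma br_brr x y z : br x (br y z) = br (br x y) z + br y (br x z).
Proof. by rewrite br_brl subrK. Qed.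

Lemma ad_br x y : ad (br x y) = (ad x \o ad y)%VF - (ad y \o ad x)%VF.
Proof.
by apply/lfunP => z; rewrite add_lfunE opp_lfunE !comp_lfunE !adE br_brl.
Qed.

Definition killingf y : 'Hom(g, F^o) := linfun (fun x => killing x y : F^o).

Lemma killingfE y x : killingf y x = killing x y.
Proof.
pose ky := GRing.isLinear.Build F g F^o _ _ (killing_linearl y).
pose kyL : {linear g -> F^o} := HB.pack (fun x => killing x y : F^o) ky.
exact: (lfunE kyL).
Qed.

Lemma killingDl x y z : killing (x + y) z = killing x z + killing y z.
Proof. by rewrite -!killingfE linearD. Qed.
Lemma killingZl a x y : killing (a *: x) y = a * killing x y.
Proof. by rewrite -!killingfE linearZ. Qed.
Lemma killingNl x y : killing (- x) y = - killing x y.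
Proof. by rewrite -!killingfE linearN. Qed.
Lemma killing0l y : killing 0 y = 0.
Proof. by rewrite -killingfE linear0. Qed.
Lemma killing_sum_l (I : Type) (r : seq I) (P : pred I) (f : I -> g) y :
  killing (\sum_(i <- r | P i) f i) y = \sum_(i <- r | P i) killing (f i) y.
Proof. by rewrite -killingfE linear_sum; apply: eq_bigr => i _; rewrite /= killingfE. Qed.
Lemma killingZr a x y : killing x (a *: y) = a * killing x y.
Proof. by rewrite !(killingC x) killingZl. Qed.
Lemma killingNr x y : killing x (- y) = - killing x y.
Proof. by rewrite !(killingC x) killingNl. Qed.
Lemma killing_sum_r (I : Type) (r : seq I) (P : pred I) (f : I -> g) x :
  killing x (\sum_(i <- r | P i) f i) = \sum_(i <- r | P i) killing x (f i).
Proof. by rewrite killingC killing_sum_l; apply: eq_bigr => i _; rewrite killingC. Qed.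

Lemma killing_br x y z : killing (br x y) z = killing x (br y z).
Proof.
have B : basis_of {:g} stdb := vbasisP _.
rewrite /killing !ad_br comp_lfunDl comp_lfunDr comp_lfunNl comp_lfunNr.
rewrite !linearB /= !(mxof_comp _ _ B) !mulmxA.
by congr (_ - _); rewrite mxtrace_mulC mulmxA.
Qed.

Lemma mem_brv U V x y : x \in U -> y \in V -> br x y \in brv U V.
Proof.
move=> /coord_vbasis-> /coord_vbasis->; rewrite br_suml memv_suml// => i _.
rewrite br_sumr memv_suml// => j _; rewrite brZl brZr !memvZ//.
apply: memv_span; apply/allpairsP; exists ((vbasis U)`_i, (vbasis V)`_j).
by split=> //=; apply: mem_nth; rewrite size_tuple.
Qed.

Lemma brv_subP U V W :
  (forall x y, x \in U -> y \in V -> br x y \in W) -> (brv U V <= W)%VS.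
Proof.
move=> H; apply/span_subvP => _ /allpairsP[[x y] [/= xU yV ->]].
by apply: H; apply: vbasis_mem.
Qed.

Definition killing_orth U : {vspace g} :=
  (\bigcap_(i < \dim U) lker (killingf (vbasis U)`_i))%VS.

Lemma mem_killing_orth U x :
  reflect (forall y, y \in U -> killing x y = 0) (x \in killing_orth U).
Proof.
apply: (iffP idP) => [xr y yh | xr]; last first.
  rewrite memvE; apply/subv_bigcapP => i _.
  rewrite -memvE memv_ker killingfE xr//.
  by apply/vbasis_mem/mem_nth; rewrite size_tuple.
have /subv_bigcapP xb : (<[x]> <= killing_orth U)%VS by rewrite -memvE.
rewrite (coord_vbasis yh) killing_sum_r big1// => i _; rewrite killingZr.
by have := xb i isT; rewrite -memvE memv_ker killingfE => /eqP->; rewrite mulr0.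
Qed.

Definition centralizer_in V U : {vspace g} :=
  (V :&: \bigcap_(i < \dim U) lker (ad (vbasis U)`_i))%VS.

Lemma mem_centralizer_in V U y :
  reflect (y \in V /\ forall x, x \in U -> br x y = 0) (y \in centralizer_in V U).
Proof.
rewrite memv_cap; apply: (iffP andP) => [[yV yr]|[yV yr]]; split => //; last first.
  rewrite memvE; apply/subv_bigcapP => i _.
  rewrite -memvE memv_ker adE yr//.
  by apply/vbasis_mem/mem_nth; rewrite size_tuple.
move=> x xU; move: yr; rewrite memvE => /subv_bigcapP yb.
rewrite (coord_vbasis xU) br_suml big1// => i _; rewrite brZl.
by have := yb i isT; rewrite -memvE memv_ker adE => /eqP->; rewrite scaler0.
Qed.

(** For U stable under f this is the trace of f on U, whatever f does outside U. *)
Definition trv U (f : 'End(g)) : F := \sum_i coord (vbasis U) i (f (vbasis U)`_i).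

Lemma trvD U f1 f2 : trv U (f1 + f2) = trv U f1 + trv U f2.
Proof.
by rewrite /trv -big_split; apply: eq_bigr => i _; rewrite add_lfunE linearD.
Qed.
Lemma trvZ U a f : trv U (a *: f) = a * trv U f.
Proof.
by rewrite /trv mulr_sumr; apply: eq_bigr => i _; rewrite scale_lfunE linearZ.
Qed.
Lemma trvB U f1 f2 : trv U (f1 - f2) = trv U f1 - trv U f2.
Proof. by rewrite trvD -scaleN1r trvZ mulN1r. Qed.

(** tr(AB) = tr(BA) for maps between two subspaces. With U = V it makes commutators traceless;
    between neighbouring levels of a tower it makes traces telescope. *)
Lemma trv_comp U V (f1 f2 : 'End(g)) :
  (forall x, x \in U -> f1 x \in V) -> (forall x, x \in V -> f2 x \in U) ->
  trv U (f2 \o f1)%VF = trv V (f1 \o f2)%VF.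
Proof.
move=> fUV fVU; rewrite /trv.
have E W1 W2 (h1 h2 : 'End(g)) i : (forall x, x \in W1 -> h1 x \in W2) ->
  coord (vbasis W1) i ((h2 \o h1)%VF (vbasis W1)`_i) =
  \sum_j coord (vbasis W2) j (h1 (vbasis W1)`_i) * coord (vbasis W1) i (h2 (vbasis W2)`_j).
  move=> H; rewrite comp_lfunE.
  have /coord_vbasis{1}-> : h1 (vbasis W1)`_i \in W2.
    by apply: H; apply/vbasis_mem/mem_nth; rewrite size_tuple.
  by rewrite !linear_sum; apply: eq_bigr => j _; rewrite !linearZ.
under eq_bigr do rewrite (E _ V)//.
under [RHS]eq_bigr do rewrite (E _ U)//.
rewrite exchange_big /=; apply: eq_bigr => j _; apply: eq_bigr => i _; exact: mulrC.
Qed.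

Lemma trv_scale U (f : 'End(g)) a :
  (forall x, x \in U -> f x = a *: x) -> trv U f = a * (\dim U)%:R.
Proof.
move=> H; rewrite /trv -[in RHS](card_ord (\dim U)) -sumr_const mulr_sumr.
apply: eq_bigr => i _; rewrite H; last by apply/vbasis_mem/mem_nth; rewrite size_tuple.
by rewrite linearZ /= coord_free ?eqxx// (basis_free (vbasisP U)).
Qed.

Lemma coord_eigenbasis n (b : n.-tuple g) (c : 'I_n -> F) (f : 'End(g)) a x l :
  basis_of fullv b -> (forall i : 'I_n, f b`_i = c i *: b`_i) ->
  f x = a *: x -> c l != a -> coord b l x = 0.
Proof.
move=> b_basis fb fx cl.
have : coord b l (f x) = c l * coord b l x.
  rewrite {1}(coord_basis b_basis (memvf x)) !linear_sum (bigD1 l)//=.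
  rewrite linearZ /= fb !linearZ /= coord_free ?(basis_free b_basis)// eqxx big1 ?addr0.
    by rewrite [_ * 1]mulr1 mulrC.
  move=> m ml; rewrite linearZ /= fb !linearZ /= coord_free ?(basis_free b_basis)//.
  by rewrite (negPf ml) [_ * 0]mulr0 mulr0.
rewrite fx linearZ /= => /eqP; rewrite -subr_eq0 -mulrBl mulf_eq0 subr_eq0 eq_sym.
by rewrite (negPf cl) => /eqP.
Qed.

End LieBasics.

Section KillingNondegenerate.
Variables (F : fieldType) (g : lieAlg F).
Implicit Types (x y z : g) (U V W : {vspace g}).
Local Notation stdb := (vbasis (fullv : {vspace g})).

Lemma killing_nondeg : simple_lie g -> (exists x y : g, killing x y <> 0) ->
  forall x : g, (forall y, killing x y = 0) -> x = 0.
Proof.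
move=> [_ sg] [x0 [y0 xy0]] x Kx.
have I : is_ideal (killing_orth {:g}).
  move=> z y /mem_killing_orth yK; apply/mem_killing_orth => t _.
  by rewrite brC killingNl killing_br yK ?memvf ?oppr0.
have xo : x \in killing_orth {:g} by apply/mem_killing_orth.
case: (sg _ I) => E; first by move: xo; rewrite E memv0 => /eqP.
by case: xy0; have := memvf x0; rewrite -E => /mem_killing_orth; apply; rewrite memvf.
Qed.

Hypothesis Knd : forall x : g, (forall y, killing x y = 0) -> x = 0.

Lemma killing_represent (f : 'Hom(g, F^o)) : exists z, forall y, f y = killing z y.
Proof.
have B : basis_of {:g} stdb := vbasisP _.
have KE (u : 'rV[F]_(\dim {:g})) j :
    (u *m killing_mx g) 0 j = killing (\sum_i u 0 i *: stdb`_i) stdb`_j.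
  by rewrite killing_suml mxE; apply: eq_bigr => i _; rewrite !mxE.
have Ku : killing_mx g \in unitmx.
  rewrite -row_free_unit -kermx_eq0; apply/eqP/row_matrixP => i.
  rewrite row0; set u := row i _.
  have u0 : u *m killing_mx g = 0.
    by rewrite /u -row_mul mulmx_ker row0.
  have : \sum_i u 0 i *: stdb`_i = 0.
    apply: Knd => y; rewrite (coord_vbasis (memvf y)) killing_sum_r big1// => j _.
    by rewrite killingZr -KE u0 mxE mulr0.
  by move/freeP: (basis_free B) => /[apply] H; apply/rowP => k; rewrite H mxE.
pose u := (\row_j (f stdb`_j : F)) *m invmx (killing_mx g).
exists (\sum_i u 0 i *: stdb`_i) => y.
rewrite (coord_vbasis (memvf y)) linear_sum killing_sum_r; apply: eq_bigr => j _.
by rewrite linearZ killingZr /= -KE /u mulmxKV// mxE.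
Qed.

End KillingNondegenerate.

(** * Graded Lie algebras *)

Section GradedLie.
Variables (F : numFieldType) (g : lieAlg F) (E : g) (n : nat) (b : n.-tuple g)
  (wt : 'I_n -> int).
Hypothesis b_basis : basis_of fullv b.
Hypothesis bE : forall i : 'I_n, br E b`_i = (wt i)%:~R *: b`_i.
Implicit Types (x y z : g) (U V W : {vspace g}) (i j : int).

Definition grade j : {vspace g} := lker (ad E - (j%:~R : F) *: \1%VF).

Lemma mem_grade j x : reflect (br E x = j%:~R *: x) (x \in grade j).
Proof.
rewrite memv_ker add_lfunE opp_lfunE scale_lfunE id_lfunE adE subr_eq0.
exact: eqP.
Qed.

Lemma grade_br i j x y : x \in grade i -> y \in grade j -> br x y \in grade (i + j).
Proof.
move=> /mem_grade xi /mem_grade yj; apply/mem_grade.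
by rewrite br_brr xi yj brZl brZr -scalerDl intrD.
Qed.

Lemma grade_E : E \in grade 0.
Proof. by apply/mem_grade; rewrite br_alt scale0r. Qed.

Lemma coord_grade j x (l : 'I_n) : x \in grade j -> wt l != j -> coord b l x = 0.
Proof.
move=> /mem_grade xj ne.
have H (i : 'I_n) : ad E b`_i = (wt i)%:~R *: b`_i by rewrite adE bE.
apply: (coord_eigenbasis b_basis H (a := j%:~R)); first by rewrite adE.
by rewrite eqr_int.
Qed.

Lemma basis_grade (l : 'I_n) : b`_l \in grade (wt l).
Proof. by apply/mem_grade. Qed.

Definition gproj j x := \sum_(l | wt l == j) coord b l x *: b`_l.

Lemma gproj_grade j x : gproj j x \in grade j.
Proof. by apply: memv_suml => l /eqP <-; rewrite memvZ// basis_grade. Qed.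

Lemma gproj_sum_seq x : x = \sum_(j <- undup [seq wt l | l : 'I_n]) gproj j x.
Proof.
rewrite {1}(coord_basis b_basis (memvf x)) /gproj (exchange_big_dep xpredT)//.
apply: eq_bigr => l _; under eq_bigl do rewrite andTb; rewrite -big_filter.
rewrite (_ : [seq i <- _ | _] = [:: wt l]) ?big_seq1//.
apply: perm_small_eq => //; apply: uniq_perm => //; first exact/filter_uniq/undup_uniq.
move=> j; rewrite mem_filter mem_undup mem_seq1.
apply/andP/eqP => [[/(@eqP int)->]//|->]; split; first exact: eqxx.
by apply/mapP; exists l; rewrite ?mem_enum.
Qed.

Lemma killing_grade i j x y :
  x \in grade i -> y \in grade j -> i + j != 0 -> killing x y = 0.
Proof.
move=> /mem_grade xi /mem_grade yj ij.
have : killing (br E x) y + killing x (br E y) = 0.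
  by rewrite brC killingNl killing_br addNr.
rewrite xi yj killingZl killingZr -mulrDl -intrD => /eqP.
by rewrite mulf_eq0 intr_eq0 (negPf ij) => /eqP.
Qed.

(** Pairing with degree -j only sees the component of degree j, so a representing vector can be
    replaced by a homogeneous one. *)
Lemma killing_gproj j z u : u \in grade (- j) -> killing (gproj j z) u = killing z u.
Proof.
move=> ug; have nz i : i != j -> killing (gproj i z) u = 0.
  by move=> ij; rewrite (killing_grade (gproj_grade _ _) ug)// subr_eq0.
have -> : killing z u = \sum_(i <- undup [seq wt l | l : 'I_n]) killing (gproj i z) u.
  by rewrite -killing_sum_l -gproj_sum_seq.
case/boolP : (j \in undup [seq wt l | l : 'I_n]) => [jn|jn].
  by rewrite (bigD1_seq j)//= ?undup_uniq// big1 ?addr0// => i; exact: nz.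
rewrite big1_seq => [|i /= ii]; last by apply: nz; apply: contraNneq jn => <-.
rewrite /gproj big1 ?killing0l// => l /eqP wl.
by move: jn; rewrite mem_undup -wl; case/negP; apply/mapP; exists l; rewrite ?mem_enum.
Qed.

Hypothesis Knd : forall x, (forall y, killing x y = 0) -> x = 0.

Lemma killing_grade_nondeg j x : x \in grade j ->
  (forall y, y \in grade (- j) -> killing x y = 0) -> x = 0.
Proof.
move=> xj H; apply: Knd => y; rewrite (gproj_sum_seq y) killing_sum_r big1_seq//.
move=> k _; have [->|kj] := eqVneq k (- j); first by rewrite H// gproj_grade.
by rewrite (killing_grade xj (gproj_grade _ _))// addrC addr_eq0.
Qed.

Definition grade0_stable W := forall z x, z \in grade 0 -> x \in W -> br z x \in W.

Hypothesis centerE : forall z, z \in grade 0 ->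
  (forall y, y \in grade 0 -> br z y = 0) -> exists c : F, z = c *: E.

(** * Towers generated by g(-1) from a subspace of negative degree *)

Section Lowering.
Variables (W W' : {vspace g}) (j : nat).
Hypotheses (j0 : (0 < j)%N) (W'sub : (W' <= grade 1)%VS) (Wsub : (W <= grade (- j%:Z))%VS)
  (W's : grade0_stable W') (Ws : grade0_stable W)
  (W'W : forall x y, x \in W' -> y \in W -> br x y = 0).

(** W serves as the top of a highest weight module: it is killed by the raising operators in W', and
    level k is reached from it by k brackets with g(-1). *)
Definition lowering k := iter k (brv (grade (-1))) W.

Lemma lowering_grade k : (lowering k <= grade (- (j + k)%:Z))%VS.
Proof.
elim: k => [|k IH]; first by rewrite addn0.
apply: brv_subP => x y xg /(subvP IH) yg.
rewrite (_ : - (j + k.+1)%:Z = -1 + - (j + k)%:Z); first exact: grade_br.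
lia.
Qed.

Lemma lowering_stable k : grade0_stable (lowering k).
Proof.
elim: k => [|k IH] //= z x z0.
have H : (lowering k.+1 <= (ad z @^-1: lowering k.+1))%VS.
  apply: brv_subP => u v ug vg; rewrite -memv_preim adE br_brr rpredD//.
    by apply: mem_brv => //; rewrite -[-1](add0r (-1)); exact: grade_br.
  by apply: mem_brv => //; exact: IH.
by move=> /(subvP H); rewrite -memv_preim adE.
Qed.

(** By Jacobi [x, [u, v]] = [[x, u], v] + [u, [x, v]]. Here [x, u] has degree 0 and preserves every
    level, so only the second term is left to the hypothesis. *)
Lemma lowering_raise_step k x y : x \in W' ->
  (forall u v, u \in grade (-1) -> v \in lowering k -> br u (br x v) \in lowering k) ->
  y \in lowering k.+1 -> br x y \in lowering k.
Proof.
move=> xW' H.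
suff {y}S : (lowering k.+1 <= (ad x @^-1: lowering k))%VS.
  by move=> /(subvP S); rewrite -memv_preim adE.
apply: brv_subP => u v ug vk; rewrite -memv_preim adE br_brr rpredD//; last exact: H.
apply: lowering_stable => //.
by rewrite -[0](subrr 1); apply: grade_br => //; exact: (subvP W'sub).
Qed.

Lemma lowering_raise k x y : x \in W' -> y \in lowering k.+1 -> br x y \in lowering k.
Proof.
move=> xW'; elim: k y => [|k IH] y yk; last first.
  apply: (lowering_raise_step xW') yk => u v ug vk; apply: mem_brv => //; exact: IH.
by apply: (lowering_raise_step xW') yk => u v ug vk; rewrite (W'W xW' vk) br0r mem0v.
Qed.

Lemma lowering_eventually0 : exists N, lowering N = 0%VS.
Proof.
(* Level N sits in degree -(j + N), below every weight [wt l]. *)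
pose N := (\max_(l < n) `|wt l|).+1%N.
exists N; apply/eqP; rewrite -subv0; apply/subvP => x /(subvP (lowering_grade N)) xg.
rewrite memv0 (coord_basis b_basis (memvf x)) big1// => l _.
rewrite (coord_grade xg) ?scale0r//.
have : (`|wt l| < N)%N by rewrite ltnS (leq_bigmax l).
move: j0; lia.
Qed.

(* The sum of the traces over the spaces [lowering k] is a functional of degree
   zero which kills [grade 0, grade 0] and, by telescoping, [W', grade (-1)];
   if W' <> 0 these span grade 0, but on E it is minus a sum of dimensions. *)
Lemma commuting_eq0 : W' != 0%VS -> W = 0%VS.
Proof.
move=> W'0; have [N UN] := lowering_eventually0.
pose phi z := \sum_(k < N) trv (lowering k) (ad z).
have phi_lin : linear (phi : g -> F^o).
  move=> a x y; rewrite /phi linearP.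
  under eq_bigr do rewrite trvD trvZ.
  by rewrite big_split -mulr_sumr.
pose phiM := GRing.isLinear.Build F g F^o _ _ phi_lin.
pose phiL : {linear g -> F^o} := HB.pack (phi : g -> F^o) phiM.
have [z0 Hz0] := killing_represent Knd (linfun phiL).
have {}Hz0 z : killing z0 z = phi z by rewrite -Hz0 lfunE.
(* Only the values of [phi] in degree 0 matter, and these are represented by the component of degree
   0. *)
pose z1 := gproj 0 z0.
have z1g : z1 \in grade 0 := gproj_grade _ _.
have Hz1 z : z \in grade 0 -> killing z1 z = phi z.
  by move=> zg; rewrite -Hz0 killing_gproj// oppr0.
have phi00 z z' : z \in grade 0 -> z' \in grade 0 -> phi (br z z') = 0.
  move=> zg zg'; rewrite /phi big1// => k _.
  rewrite ad_br trvB (@trv_comp _ _ _ (lowering k)) ?subrr// => x;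
    rewrite adE; exact: lowering_stable.
have phi1 x y : x \in W' -> y \in grade (-1) -> phi (br x y) = 0.
  move=> xW' yg; rewrite /phi.
  pose T k := trv (lowering k) (ad y \o ad x)%VF.
  have E1 k : trv (lowering k) (ad (br x y)) = T k.+1 - T k.
    rewrite ad_br trvB (@trv_comp _ _ _ (lowering k.+1))// => v; rewrite adE.
      by move=> vk; apply: mem_brv.
    exact: lowering_raise.
  under eq_bigr do rewrite E1.
  rewrite -(big_mkord xpredT (fun k => T k.+1 - T k)) telescope_sumr//.
  rewrite /T [X in X - _](_ : _ = 0); last first.
    rewrite (@trv_scale _ _ _ _ 0) ?mul0r// UN => v.
    by rewrite memv0 => /eqP->; rewrite linear0 scaler0.
  rewrite (@trv_scale _ _ _ _ 0) ?mul0r ?subrr// => v vW.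
  by rewrite comp_lfunE !adE (W'W xW' vW) br0r scale0r.
(* [phi] kills [g(0), g(0)], so by invariance [z1, z'] is orthogonal to g(0) for z' in g(0): z1 is
   central in g(0). *)
have [c Ec] : exists c : F, z1 = c *: E.
  apply: centerE => // z' zg'.
  apply: (@killing_grade_nondeg 0); first by rewrite -[0](addr0 0) grade_br.
  rewrite oppr0 => y yg; rewrite killing_br Hz1 ?phi00//.
  by rewrite -[0](addr0 0) grade_br.
(* For x in W' and y in g(-1), 0 = [phi] [x, y] = c killing(E, [x, y]) = c killing(x, y), since
   [E, x] = x. A nonzero c would force x = 0. *)
have c0 : c = 0.
  have [x xW' x0] : exists2 x, x \in W' & x != 0.
    by exists (vpick W'); rewrite ?memv_pick ?vpick0.
  have xg := subvP W'sub _ xW'.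
  apply/eqP/negPn/negP => c0; case/negP : x0; apply/eqP.
  apply: (killing_grade_nondeg xg) => y yg.
  have : killing z1 (br x y) = 0.
    by rewrite Hz1 ?phi1// -[0](subrr 1) grade_br.
  rewrite -killing_br Ec brZl; move/mem_grade: xg => ->; rewrite scale1r killingZl.
  by move/eqP; rewrite mulf_eq0 (negPf c0) => /eqP.
(* E acts on level k as the scalar -(j + k), so [phi] E is minus a sum of natural numbers. Each of
   them vanishes, in particular the one for k = 0, which is j times the dimension of W. *)
have : phi E = 0 by rewrite -Hz1 ?grade_E// Ec c0 scale0r killing0l.
rewrite /phi.
rewrite (eq_bigr (fun k : 'I_N => - (j + k)%:R * (\dim (lowering k))%:R)); last first.
  move=> k _; apply: trv_scale => x /(subvP (lowering_grade _)) /mem_grade; rewrite adE => ->.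
  by rewrite mulrNz.
under eq_bigr => k _ do rewrite mulNr -natrM.
rewrite sumrN -natr_sum => /eqP; rewrite oppr_eq0 pnatr_eq0.
(* For N = 0 the vanishing level is W itself. *)
case: N UN {phi phi_lin phiM phiL Hz0 Hz1 phi00 phi1} => [//|N] UN.
rewrite big_ord_recl addn_eq0 muln_eq0 addn0 => /andP[+ _].
by rewrite (gtn_eqF j0) /= dimv_eq0 => /eqP.
Qed.

End Lowering.

Lemma grade0_stable_grade j : grade0_stable (grade j).
Proof. by move=> z x z0 xj; rewrite -[j]add0r; exact: grade_br. Qed.

(* [commuting_eq0] applies to W and its annihilator in [grade 1]. *)
Lemma grade_N1_irreducible W : (W <= grade (-1))%VS -> grade0_stable W ->
  W != 0%VS -> W = grade (-1).
Proof.
move=> Wsub Ws W0.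
pose W' := (grade 1 :&: killing_orth W)%VS.
have W's : grade0_stable W'.
  move=> z x zg /memv_capP[xg /mem_killing_orth xW]; apply/memv_capP; split.
    exact: grade0_stable_grade.
  apply/mem_killing_orth => y yW.
  by rewrite brC killingNl killing_br xW ?oppr0//; exact: Ws.
(* [x, y] lies in g(0), and killing([x, y], z) = killing(x, [y, z]) = 0 for z in g(0) because W is
   stable; nondegeneracy in degree 0 gives [x, y] = 0. *)
have W'W x y : x \in W' -> y \in W -> br x y = 0.
  move=> /memv_capP[xg /mem_killing_orth xW] yW.
  apply: (@killing_grade_nondeg 0).
    by rewrite -[0](subrr 1) grade_br// (subvP Wsub).
  rewrite oppr0 => z zg; rewrite killing_br brC killingNr xW ?oppr0//; exact: Ws.
have [W'0|W'0] := eqVneq W' 0%VS; last first.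
  by move: W0; rewrite (@commuting_eq0 W W' 1) ?eqxx// capvSl.
apply/eqP; rewrite eqEsubv Wsub; apply/subvP => y yg; apply/negPn/negP => yW.
have v0 : y - projv W y != 0.
  by apply: contra yW; rewrite subr_eq0 => /eqP->; exact: memv_proj.
have [l cl] : exists l, coord b l (y - projv W y) != 0.
  apply/existsP; apply: contraNT v0; rewrite negb_exists => /forallP c0.
  rewrite (coord_basis b_basis (memvf (y - _))) big1// => l _.
  by have := c0 l; rewrite negbK => /eqP->; rewrite scale0r.
(* A linear form that vanishes on W but not at y. The component of degree 1 of its representing
   vector would be a nonzero element of W'. *)
pose f u : F^o := coord b l (u - projv W u).
have f_lin : linear f.
  by move=> a u v; rewrite /f -linearZ -linearD /= linearP opprD addrACA scalerBr.
pose fM := GRing.isLinear.Build F g F^o _ _ f_lin.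
pose fL : {linear g -> F^o} := HB.pack f fM.
have [z Hz] := killing_represent Knd (linfun fL).
have {}Hz u : killing z u = f u by rewrite -Hz lfunE.
have zf u : u \in grade (-1) -> killing (gproj 1 z) u = f u.
  by move=> ug; rewrite -Hz killing_gproj.
have : gproj 1 z \in W'.
  apply/memv_capP; split; first exact: gproj_grade.
  apply/mem_killing_orth => u uW; rewrite zf ?(subvP Wsub)//.
  by rewrite /f projv_id// subrr linear0.
rewrite W'0 memv0 => /eqP z0.
by move: cl; rewrite -/(f y) -zf// z0 killing0l eqxx.
Qed.

(** * Vanishing of the degrees beyond 2 *)

Hypothesis g1_neq0 : grade 1 != 0%VS.

(** [commuting_eq0] with W' the whole of g(1) and W its centralizer in g(-j). Under the Killing form
    this is dual to g(j) = [g(1), g(j-1)]. *)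
Lemma grade_centralizer_eq0 (j : nat) y : (1 < j)%N -> y \in grade (- j%:Z) ->
  (forall x, x \in grade 1 -> br x y = 0) -> y = 0.
Proof.
move=> j1 yg Hy.
have C0 : centralizer_in (grade (- j%:Z)) (grade 1) = 0%VS.
  apply: (@commuting_eq0 _ (grade 1) j) => //.
  - exact: ltnW.
  - exact: capvSl.
  - move=> z x zg /mem_centralizer_in[xg Hx]; apply/mem_centralizer_in; split.
      exact: grade0_stable_grade.
    move=> u ug; rewrite br_brr (Hx u ug) br0r addr0.
    by apply: Hx; rewrite brC rpredN; exact: grade0_stable_grade.
  - by move=> x u xg /mem_centralizer_in[_]; exact.
have : y \in centralizer_in (grade (- j%:Z)) (grade 1) by apply/mem_centralizer_in.
by rewrite C0 memv0 => /eqP.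
Qed.

Hypothesis g1_nil : forall x y z, x \in grade 1 -> y \in grade 1 -> z \in grade 1 ->
  br x (br y z) = 0.

(** In degree -3, killing([x2, [x1, y]], x3) = killing(y, [x1, [x2, x3]]) = 0, so [x2, [x1, y]] = 0,
    and two uses of [grade_centralizer_eq0] give y = 0. In lower degrees, bracketing with g(1) lands
    in a space already known to vanish. *)
Lemma grade_N3_eq0 (j : nat) : (2 < j)%N -> grade (- j%:Z) = 0%VS.
Proof.
elim: j => // j IH; rewrite ltnS leq_eqVlt => /orP[/eqP<-|j2].
  apply/eqP; rewrite -subv0; apply/subvP => y yg; rewrite memv0; apply/eqP.
  apply: (@grade_centralizer_eq0 3) => // x1 x1g.
  have x1y : br x1 y \in grade (- 2%:Z).
    by rewrite (_ : - 2%:Z = 1 + - 3%:Z)// grade_br.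
  apply: (@grade_centralizer_eq0 2) => // x2 x2g.
  apply: (@killing_grade_nondeg (-1)).
    by rewrite (_ : -1 = 1 + - 2%:Z)// grade_br.
  rewrite opprK => x3 x3g.
  rewrite brC killingNl killing_br brC killingNl opprK killing_br.
  by rewrite g1_nil// killingC killing0l.
apply/eqP; rewrite -subv0; apply/subvP => y yg; rewrite memv0; apply/eqP.
apply: (@grade_centralizer_eq0 j.+1) => // [|x xg]; first by lia.
apply/eqP; rewrite -memv0 -IH//.
by rewrite (_ : - j%:Z = 1 + - j.+1%:Z) ?grade_br//; lia.
Qed.

Lemma grade_gt2_eq0 (j : int) : (2 < `|j|)%N -> grade j = 0%VS.
Proof.
have [j0 H|j0 H] := ltP j 0.
  by rewrite (_ : j = - `|j|%:Z); [exact: grade_N3_eq0|lia].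
apply/eqP; rewrite -subv0; apply/subvP => y yg; rewrite memv0; apply/eqP.
apply: (killing_grade_nondeg yg) => u.
rewrite (_ : - j = - `|j|%:Z); last by lia.
by rewrite grade_N3_eq0// memv0 => /eqP->; rewrite killingC killing0l.
Qed.

End GradedLie.

(** * Root space decomposition *)

Section Codiagonalization.
Variables (F : fieldType) (g : lieAlg F).
Local Notation stdb := (vbasis (fullv : {vspace g})).

Lemma diagonalizable_eigenbasis (f : 'End(g)) (e : seq g) :
  basis_of fullv e -> (forall v, v \in e -> exists c, f v = c *: v) ->
  diagonalizable (mxof stdb stdb f).
Proof.
move=> eb H.
have /choice[c Hc] : forall v, exists c, v \in e -> f v = c *: v.
  by move=> v; case: (pselect (v \in e)) => [/H[c ?]|?]; [exists c|exists 0].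
apply/diagonalizablePeigen; exists (undup [seq c v | v <- e]); first exact: undup_uniq.
apply/eqmxP; rewrite submx1 /=; apply/row_subP => i.
rewrite row1 -(rVofE (vbasisP _)).
have -> : stdb`_i = \sum_(k < size e) coord (in_tuple e) k stdb`_i *: e`_k.
  by rewrite -(coord_basis (X := in_tuple e) eb (memvf _)).
rewrite linear_sum /= summx_sub// => k _; rewrite linearZ /= scalemx_sub//.
have ke : e`_k \in e by rewrite mem_nth.
rewrite (big_rem (c e`_k)) /=; last by rewrite mem_undup; apply/mapP; exists e`_k.
apply: submx_trans (addsmxSl _ _); apply/eigenspaceP.
by rewrite -(rVof_app _ (vbasisP _)) Hc// linearZ.
Qed.

(** Codiagonalization of the matrices in the basis [stdb]; the rows of the diagonalizing matrix P
    are the coordinates of the common eigenvectors. *)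
Lemma codiagonalizable_eigenbasis r (f : 'I_r -> 'End(g)) :
  (forall i, exists2 e : seq g, basis_of fullv e &
     forall v, v \in e -> exists c, f i v = c *: v) ->
  (forall i j x, f i (f j x) = f j (f i x)) ->
  exists (b : (\dim {:g}).-tuple g) (c : 'I_r -> 'I_(\dim {:g}) -> F),
    basis_of fullv b /\ forall i (l : 'I_(\dim {:g})), f i b`_l = c i l *: b`_l.
Proof.
move=> fd fC; have B := vbasisP {:g}; have Bf := basis_free B.
pose As := [seq mxof stdb stdb (f i) | i : 'I_r].
have /codiagonalizableP[P Pu /allP PA] : {in As &, forall A B, comm_mx A B} /\
    {in As, forall A, diagonalizable A}.
  split=> [_ _ /mapP[i _ ->] /mapP[j _ ->]|_ /mapP[i _ ->]].
    rewrite /comm_mx -!(mxof_comp _ _ B); congr mxof.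
    by apply/lfunP => x; rewrite !comp_lfunE fC.
  by have [e eb H] := fd i; exact: diagonalizable_eigenbasis eb H.
have {}PA i : exists d, P *m mxof stdb stdb (f i) = diag_mx d *m P.
  have /PA /= : mxof stdb stdb (f i) \in As by apply/mapP; exists i; rewrite ?mem_enum.
  by move=> /diagonalizable_forPex[d /(simmxP Pu) Hd]; exists d.
have /choice[d Hd] := PA.
pose b := [tuple vecof stdb (row l P) | l < \dim {:g}].
have bl (l : 'I__) : b`_l = vecof stdb (row l P).
  by rewrite -tnth_nth tnth_mktuple.
exists b, (fun i l => d i 0 l); split.
  rewrite basisEfree subvf size_tuple leqnn !andbT; apply/freeP => k.
  under eq_bigr do rewrite bl -linearZ /=.
  rewrite -linear_sum /= => /eqP; rewrite vecof_eq0// => /eqP k0 l.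
  pose u := \row_l k l.
  have : u *m P = 0.
    rewrite -k0; apply/rowP => m; rewrite mxE summxE.
    by apply: eq_bigr => j _; rewrite !mxE.
  move/(congr1 (mulmx^~ (invmx P))); rewrite mulmxK// mul0mx => /rowP/(_ l).
  by rewrite !mxE.
move=> i l; rewrite bl.
apply: (can_inj (rVofK B)); rewrite (rVof_app _ B) linearZ /= vecofK//.
by rewrite -row_mul Hd row_mul row_diag_mx -scalemxAl -rowE.
Qed.

End Codiagonalization.

Section RootDecomposition.
Local Open Scope complex_scope.
Variables (R : realType) (g : lieAlg R[i]) (p : maxParabolic g).
Local Notation h := (csa p).
Local Notation dual := 'Hom(subvs_of h, R[i]^o).
Implicit Types (x y z : g) (a : dual).

Lemma coord_linear n (vT : vectType R[i]) (X : n.-tuple vT) k :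
  linear (coord X k : vT -> R[i]^o).
Proof. by move=> c x y; rewrite linearP. Qed.

Definition coordf n (vT : vectType R[i]) (X : n.-tuple vT) k : 'Hom(vT, R[i]^o) :=
  linfun (coord X k : vT -> R[i]^o).

Lemma coordfE n (vT : vectType R[i]) (X : n.-tuple vT) k v : coordf X k v = coord X k v.
Proof.
pose cM := GRing.isLinear.Build R[i] vT R[i]^o _ _ (coord_linear X k).
pose cL : {linear vT -> R[i]^o} := HB.pack (coord X k : vT -> R[i]^o) cM.
exact: (lfunE cL).
Qed.

Definition dual_coord (k : 'I_(\dim h)) : dual :=
  (coordf (vbasis h) k \o linfun (vsval : subvs_of h -> g))%VF.

Lemma dual_coordE k y : y \in h -> dual_app (dual_coord k) y = coord (vbasis h) k y.
Proof. by move=> yh; rewrite /dual_app comp_lfunE coordfE lfunE /= vsprojK. Qed.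

Lemma dual_app_linear a : linear (dual_app a : g -> R[i]^o).
Proof. by move=> c x y; rewrite /dual_app !linearP. Qed.

HB.instance Definition _ a :=
  GRing.isLinear.Build R[i] g R[i]^o _ (dual_app a : g -> R[i]^o) (dual_app_linear a).

Lemma dual_app_suml (I : Type) (r : seq I) (P : pred I) (c : I -> R[i]) (f : I -> dual) y :
  dual_app (\sum_(i <- r | P i) c i *: f i) y = \sum_(i <- r | P i) c i * dual_app (f i) y.
Proof.
by rewrite /dual_app sum_lfunE; apply: eq_bigr => i _; rewrite scale_lfunE.
Qed.

Lemma dual_coord_decomp a : a = \sum_(k < \dim h) dual_app a (vbasis h)`_k *: dual_coord k.
Proof.
apply/lfunP => u; rewrite sum_lfunE.
have {1}-> : u = vsproj h (vsval u) by rewrite vsvalK.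
rewrite -/(dual_app a (vsval u)) {1}(coord_vbasis (subvsP u)).
rewrite linear_sum; apply: eq_bigr => k _.
by rewrite linearZ /= scale_lfunE comp_lfunE coordfE lfunE; exact: mulrC.
Qed.

Lemma dual_app_inj a a' : (forall y, y \in h -> dual_app a y = dual_app a' y) -> a = a'.
Proof.
move=> H; rewrite (dual_coord_decomp a) (dual_coord_decomp a').
by apply: eq_bigr => k _; rewrite H//; apply/vbasis_mem/mem_nth; rewrite size_tuple.
Qed.

Lemma csa_abelian x y : x \in h -> y \in h -> br x y = 0.
Proof. by case: (csaP p) => H _ _; exact: H. Qed.

Lemma rootspace0P x : reflect (forall y, y \in h -> br y x = 0) (x \in h).
Proof.
apply: (iffP idP) => [xh y yh|]; first exact: csa_abelian.
by case: (csaP p) => _ H _; exact: H.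
Qed.

Lemma rootspace_0 : rootspace (0 : dual) = h.
Proof.
apply/vspaceP => x; apply/mem_rootspace/rootspace0P => H y yh.
  by rewrite H// /dual_app zero_lfunE scale0r.
by rewrite H// /dual_app zero_lfunE scale0r.
Qed.

Lemma weight_basis : exists (b : (\dim {:g}).-tuple g) (w : 'I_(\dim {:g}) -> dual),
  basis_of fullv b /\ forall l : 'I_(\dim {:g}), b`_l \in rootspace (w l).
Proof.
case: (csaP p) => habel _ hdiag.
have hk (k : 'I_(\dim h)) : (vbasis h)`_k \in h.
  by apply/vbasis_mem/mem_nth; rewrite size_tuple.
have [k|k k' x|b [c [bb bc]]] := @codiagonalizable_eigenbasis _ g _
    (fun k : 'I_(\dim h) => ad (vbasis h)`_k).
- have [e eb He] := hdiag _ (hk k); exists e => // v /He[c Hc].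
  by exists c; rewrite adE.
- by rewrite !adE br_brr (habel _ _ (hk k) (hk k')) br0l add0r.
exists b, (fun l => \sum_k c k l *: dual_coord k); split=> // l.
apply/mem_rootspace => y yh.
rewrite dual_app_suml {1}(coord_vbasis yh) br_suml scaler_suml.
apply: eq_bigr => k _; rewrite brZl -adE bc scalerA dual_coordE// mulrC.
by [].
Qed.

(** The fundamental coweight of alpha_q: every linear form on h takes on it the value of its
    alpha_q-coefficient, see [dual_app_grading_elt]. *)
Definition grading_elt : g :=
  \sum_(k < \dim h) coord (simples p) (simple_q p) (dual_coord k) *: (vbasis h)`_k.
Local Notation E := grading_elt.
Local Notation deg := (coord (simples p) (simple_q p)).

Lemma grading_elt_csa : E \in h.
Proof.
by apply: memv_suml => k _; rewrite memvZ//; apply/vbasis_mem/mem_nth; rewrite size_tuple.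
Qed.

Lemma dual_app_grading_elt a : dual_app a E = deg a.
Proof.
rewrite [in RHS](dual_coord_decomp a) !linear_sum; apply: eq_bigr => k _.
by rewrite !linearZ /= mulrC.
Qed.

Lemma rootspace_grading a x : x \in rootspace a -> br E x = deg a *: x.
Proof. by move/mem_rootspace => ->; rewrite ?dual_app_grading_elt// grading_elt_csa. Qed.

Lemma simples_free : free (simples p).
Proof. by case: (simplesP p) => _ /basis_free. Qed.

Lemma root_coords a : a \in Defs.roots p -> exists c : 'I_(rank p) -> nat,
  (forall i, coord (simples p) i a = (c i)%:R) \/ (forall i, coord (simples p) i a = - (c i)%:R).
Proof.
case: (simplesP p) => _ _ H /H[c Hc]; exists c.
have E i : coord (simples p) i (\sum_(i < rank p) (c i)%:R *: (simples p)`_i) = (c i)%:R.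
  by rewrite coord_sum_free ?simples_free.
by case: Hc => ->; [left|right] => i; rewrite ?linearN /= E.
Qed.

Lemma deg_root a : a \in Defs.roots p -> exists j : int, deg a = j%:~R.
Proof.
move=> /root_coords[c [H|H]]; rewrite H; [by exists (c (simple_q p))|].
by exists (- (c (simple_q p))%:Z); rewrite mulrNz.
Qed.

Lemma levi_rootE a : levi_root a = (deg a == 0).
Proof.
have sb : basis_of fullv (simples p) by case: (simplesP p).
apply/idP/idP => [|/eqP d0].
  rewrite /levi_root; set X := [seq _ | _ <- _ & _] => aX.
  suff : (<<X>> <= lker (coordf (simples p) (simple_q p)))%VS.
    by move=> /subvP/(_ _ aX); rewrite memv_ker coordfE.
  apply/span_subvP => _ /mapP[i + ->]; rewrite mem_filter => /andP[iq _].
  rewrite memv_ker coordfE /= (tnth_nth 0) coord_free ?simples_free//.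
  by rewrite eq_sym (negPf iq).
rewrite /levi_root (coord_basis sb (memvf a)) (bigD1 (simple_q p))//= d0 scale0r add0r.
apply: memv_suml => i iq; rewrite memvZ// memv_span//.
apply/mapP; exists i; last exact: esym (tnth_nth _ _ _).
by rewrite mem_filter iq mem_enum.
Qed.

Lemma pos_root_deg a : a \in Defs.roots p -> 0 < deg a -> pos_root a.
Proof.
move=> /root_coords[c [H|H]] d0; apply/forallP => i; rewrite H ?ler0n//.
by move: d0; rewrite H oppr_gt0 ltrn0.
Qed.

End RootDecomposition.

(** * The grading defined by a maximal parabolic subalgebra *)

Section WeightBasis.
Local Open Scope complex_scope.
Variables (R : realType) (g : lieAlg R[i]) (p : maxParabolic g).
Local Notation h := (csa p).
Local Notation dual := 'Hom(subvs_of h, R[i]^o).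
Local Notation E := (grading_elt p).
Local Notation deg := (coord (simples p) (simple_q p)).
Implicit Types (x : g) (a : dual).
Variables (b : (\dim {:g}).-tuple g) (w : 'I_(\dim {:g}) -> dual).
Hypothesis b_basis : basis_of fullv b.
Hypothesis bw : forall l : 'I_(\dim {:g}), b`_l \in rootspace (w l).

Lemma basis_neq0 (l : 'I_(\dim {:g})) : b`_l != 0.
Proof.
apply: contraTneq (basis_free b_basis) => b0; apply/negP => /freeP /(_ (fun k => (k == l)%:R)).
rewrite (bigD1 l)//= eqxx scale1r b0 big1 ?addr0 => [|i /negPf->]; last by rewrite scale0r.
by move=> /(_ erefl l); rewrite eqxx => /eqP; rewrite oner_eq0.
Qed.

Lemma weight_root l : w l = 0 \/ w l \in Defs.roots p.
Proof.
have [|w0] := eqVneq (w l) 0; [by left|right].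
apply/rootsP; split; first exact/eqP.
by move=> r0; move: (bw l); rewrite r0 memv0 (negPf (basis_neq0 l)).
Qed.

Lemma coord_rootspace a x l : x \in rootspace a -> w l <> a -> coord b l x = 0.
Proof.
move=> /mem_rootspace xa wa; apply/eqP/negPn/negP => /eqP c0; apply: wa.
apply: dual_app_inj => y yh; apply/eqP/negPn/negP => ne; apply: c0.
have H (i : 'I_(\dim {:g})) : ad y b`_i = dual_app (w i) y *: b`_i.
  by rewrite adE; move/mem_rootspace: (bw i) => ->.
by apply: (coord_eigenbasis b_basis H (a := dual_app a y)); rewrite ?adE ?xa.
Qed.

End WeightBasis.

Section ParabolicGrading.
Local Open Scope complex_scope.
Variables (R : realType) (g : lieAlg R[i]) (p : maxParabolic g).
Local Notation h := (csa p).
Local Notation dual := 'Hom(subvs_of h, R[i]^o).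
Local Notation E := (grading_elt p).
Local Notation deg := (coord (simples p) (simple_q p)).
Implicit Types (x y z : g) (a : dual).

Lemma weighted_basis : exists (b : (\dim {:g}).-tuple g)
    (w : 'I_(\dim {:g}) -> dual) (wt : 'I_(\dim {:g}) -> int),
  [/\ basis_of fullv b, forall l : 'I_(\dim {:g}), b`_l \in rootspace (w l),
    forall l, deg (w l) = (wt l)%:~R
   & forall l : 'I_(\dim {:g}), br E b`_l = (wt l)%:~R *: b`_l].
Proof.
have [b [w [bb bw]]] := weight_basis p.
have /choice[wt H] : forall l, exists j : int, deg (w l) = j%:~R.
  move=> l; have [->|/deg_root//] := weight_root bb bw l.
  by exists 0; rewrite linear0.
by exists b, w, wt; split=> // l; rewrite (rootspace_grading (bw l)) H.
Qed.

Lemma csa_grade0 x : x \in h -> x \in grade E 0.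
Proof.
by move=> xh; apply/mem_grade; rewrite (@csa_abelian _ _ p) ?grading_elt_csa// scale0r.
Qed.

Lemma rootspace_grade a x (j : int) : x \in rootspace a -> deg a = j%:~R -> x \in grade E j.
Proof. by move=> xa dj; apply/mem_grade; rewrite (rootspace_grading xa) dj. Qed.

Lemma mem_rootspace_sum a x (P : pred dual) : a \in Defs.roots p -> P a -> x \in rootspace a ->
  x \in (\sum_(a <- Defs.roots p | P a) rootspace a)%VS.
Proof.
move=> ar Pa; apply/subvP; rewrite (big_rem a)//= Pa; exact: addvSl.
Qed.

Lemma rootspace_sum_sub (P : pred dual) (U : {vspace g}) :
  (forall a, a \in Defs.roots p -> P a -> (rootspace a <= U)%VS) ->
  (\sum_(a <- Defs.roots p | P a) rootspace a <= U)%VS.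
Proof.
move=> H; rewrite big_seq_cond; elim/big_ind: _; first exact: sub0v.
- by move=> U1 U2 s1 s2; rewrite subv_add s1.
- by move=> a /andP[]; exact: H.
Qed.

(** This carries the results on eigenspaces of ad E over to the spaces defined by roots. A weight
    vector of degree j lies in a root space or, if its weight is 0, in h, and the latter occurs only
    for j = 0. *)
Lemma gr_grade j : gr p j = grade E j.
Proof.
have [b [w [wt [bb bw wtE bE]]]] := weighted_basis.
apply/eqP; rewrite eqEsubv; apply/andP; split.
  rewrite subv_add; apply/andP; split.
    have [->|_] := eqVneq j 0; last exact: sub0v.
    by apply/subvP => x; exact: csa_grade0.
  apply: rootspace_sum_sub => a ar /eqP da; apply/subvP => x xa.
  exact: rootspace_grade xa da.
apply/subvP => x xj; rewrite (coord_basis bb (memvf x)); apply: memv_suml => l _.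
have [wl|wl] := eqVneq (wt l) j; last first.
  by rewrite (coord_grade bb bE xj wl) scale0r mem0v.
rewrite memvZ//; have [w0|wr] := weight_root bb bw l.
  have j0 : j = 0.
    by apply/eqP; rewrite -wl -(intr_eq0 R[i]) -wtE w0 linear0.
  rewrite /gr j0 eqxx; apply: (subvP (addvSl _ _)).
  by rewrite -rootspace_0 -w0.
apply: (subvP (addvSr _ _)); apply: (mem_rootspace_sum wr) => //.
by rewrite wtE wl.
Qed.

Lemma levi_gr0 : levi p = gr p 0.
Proof.
by rewrite /levi /gr eqxx; congr (_ + _)%VS; apply: eq_bigl => a; rewrite levi_rootE.
Qed.

Lemma gr_nilrad j : 0 < j -> (gr p j <= nilrad p)%VS.
Proof.
move=> j0; rewrite /gr gt_eqF// add0v; apply: rootspace_sum_sub => a ar /eqP da.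
apply/subvP => x; apply: mem_rootspace_sum => //.
by rewrite levi_rootE da intr_eq0 gt_eqF// andbT pos_root_deg// da ltr0z.
Qed.

Lemma gr_br i j x y : x \in gr p i -> y \in gr p j -> br x y \in gr p (i + j).
Proof. by rewrite !gr_grade; exact: grade_br. Qed.

Lemma gr1_neq0 : gr p 1 != 0%VS.
Proof.
have qr : (simples p)`_(simple_q p) \in Defs.roots p.
  by case: (simplesP p) => H _ _; apply/H/mem_nth; rewrite size_tuple.
have [_ r0] : is_root (simples p)`_(simple_q p) by apply/rootsP.
apply: contra_notN r0 => /eqP g10.
apply/eqP; rewrite -subv0 -g10; apply/subvP => x xr; rewrite gr_grade.
by apply: (rootspace_grade xr); rewrite coord_free ?simples_free// eqxx.
Qed.

Lemma gr1_nil : quasi_heisenberg p -> forall x y z,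
  x \in grade E 1 -> y \in grade E 1 -> z \in grade E 1 -> br x (br y z) = 0.
Proof.
move=> [n3 _] x y z; rewrite -gr_grade => /(subvP (gr_nilrad ltr01)) xn.
move=> /(subvP (gr_nilrad ltr01)) yn /(subvP (gr_nilrad ltr01)) zn.
by apply/eqP; rewrite -memv0 -n3; do 2!apply: mem_brv => //.
Qed.

Lemma csa_eq0 x : x \in h ->
  (forall i : 'I_(rank p), dual_app (simples p)`_i x = 0) -> x = 0.
Proof.
move=> xh H; rewrite (coord_vbasis xh) big1// => k _.
have sb : basis_of fullv (simples p) by case: (simplesP p).
rewrite -dual_coordE// (coord_basis sb (memvf (dual_coord k))).
by rewrite dual_app_suml big1 ?scale0r// => i _; rewrite H mulr0.
Qed.

(** Maximality of q enters here. z centralizes h, hence lies in h; every simple root other than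
    alpha_q has a root vector in g(0), which commutes with z, so z is determined by the value of
    alpha_q on it. *)
Lemma gr0_center z : z \in grade E 0 ->
  (forall y, y \in grade E 0 -> br z y = 0) -> exists c, z = c *: E.
Proof.
move=> z0 zc.
have zh : z \in h.
  by apply/rootspace0P => y /csa_grade0 y0; rewrite brC zc ?oppr0.
exists (dual_app (simples p)`_(simple_q p) z); apply/eqP; rewrite -subr_eq0; apply/eqP.
apply: csa_eq0; first by rewrite rpredB ?rpredZ// grading_elt_csa.
move=> i; rewrite linearB linearZ /= dual_app_grading_elt coord_free ?simples_free//.
have [->|iq] := eqVneq i (simple_q p).
  by rewrite [_ *: _]mulr1 subrr.
rewrite [_ *: _]mulr0 subr0.
have ir : (simples p)`_i \in Defs.roots p.
  by case: (simplesP p) => H _ _; apply/H/mem_nth; rewrite size_tuple.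
have [_ r0] : is_root (simples p)`_i by apply/rootsP.
have [x xr x0] : exists2 x, x \in rootspace (simples p)`_i & x != 0.
  exists (vpick (rootspace (simples p)`_i)); rewrite ?memv_pick// vpick0; exact/eqP.
have xg : x \in grade E 0.
  by apply: (rootspace_grade xr); rewrite coord_free ?simples_free// (negPf iq).
move/mem_rootspace: xr => /(_ z zh); rewrite zc// => /esym/eqP.
by rewrite scaler_eq0 (negPf x0) orbF => /eqP.
Qed.

(** [daddv_pi] is the identity on its first space only if the two spaces meet trivially; the weight
    basis shows that h and the sum of the root spaces do. *)
Lemma dchar_csa (lam : dual) x : x \in h -> dchar lam x = dual_app lam x.
Proof.
have [b [w [wt [bb bw wtE bE]]]] := weighted_basis.
move=> xh; rewrite /dchar daddv_pi_id//.
apply/eqP; rewrite -subv0; apply/subvP => y /memv_capP[yh yr].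
rewrite memv0 (coord_basis bb (memvf y)) big1// => l _.
have [w0|w0] := eqVneq (w l) 0; last first.
  rewrite (coord_rootspace bb bw (a := 0)) ?scale0r//; last exact/eqP.
  by rewrite rootspace_0.
suff : y \in lker (coordf b l) by rewrite memv_ker coordfE => /eqP->; rewrite scale0r.
apply: subvP yr; apply: rootspace_sum_sub => a ar _; apply/subvP => u ur.
rewrite memv_ker coordfE (coord_rootspace bb bw ur)// w0 => a0.
have [na _] : is_root a by apply/rootsP.
exact: na (esym a0).
Qed.

Hypothesis Knd : forall x, (forall y, killing x y = 0) -> x = 0.

Lemma fund_weight_br (lam : dual) : is_fund_weight lam ->
  exists x z, [/\ x \in gr p 1, z \in gr p (-1) & dchar lam (br z x) != 0].
Proof.
have [b [w [wt [bb bw wtE bE]]]] := weighted_basis.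
move=> Hlam; set aq := (simples p)`_(simple_q p).
have qr : aq \in Defs.roots p.
  by case: (simplesP p) => H _ _; apply/H/mem_nth; rewrite size_tuple.
have degq : deg aq = 1 by rewrite coord_free ?simples_free// eqxx.
have [_ r0] : is_root aq by apply/rootsP.
have [x xr x0] : exists2 x, x \in rootspace aq & x != 0.
  exists (vpick (rootspace aq)); rewrite ?memv_pick// vpick0; exact/eqP.
(* Some weight vector pairs nontrivially with x, and invariance of the Killing form forces its
   weight to be -alpha_q. *)
have [l xl] : exists l : 'I_(\dim {:g}), killing x b`_l != 0.
  apply/existsP; apply: contraNT x0; rewrite negb_exists => /forallP H.
  apply/eqP/Knd => y; rewrite (coord_basis bb (memvf y)) killing_sum_r big1// => l _.
  by rewrite killingZr; have := H l; rewrite negbK => /eqP->; rewrite mulr0.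
have wl : w l = - aq.
  apply: dual_app_inj => y yh; rewrite [RHS]/dual_app opp_lfunE -/(dual_app aq y).
  apply/eqP; rewrite -addr_eq0; apply/eqP.
  have : killing (br y x) b`_l + killing x (br y b`_l) = 0.
    by rewrite brC killingNl killing_br addNr.
  move/mem_rootspace: (xr) => ->//; move/mem_rootspace: (bw l) => ->//.
  rewrite killingZl killingZr -mulrDl addrC => /eqP.
  by rewrite mulf_eq0 (negPf xl) orbF => /eqP.
set z := b`_l in xl; have zr : z \in rootspace (- aq) by rewrite -wl bw.
(* killing([x, z], y) = killing(x, z) alpha_q(y) for y in h, so with this normalization t represents
   alpha_q as [is_coroot] asks. *)
pose t := (killing x z)^-1 *: br x z.
have xzh : br x z \in h.
  apply/rootspace0P => y yh; rewrite br_brr.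
  have /mem_rootspace/(_ y yh)-> := xr; have /mem_rootspace/(_ y yh)-> := zr.
  by rewrite brZl brZr -scalerDl /dual_app opp_lfunE subrr scale0r.
have th : t \in h by rewrite memvZ.
have tE y : y \in h -> killing t y = dual_app aq y.
  move=> yh; rewrite killingZl killing_br brC.
  move/mem_rootspace: (zr) => ->//; rewrite {1}/dual_app opp_lfunE -/(dual_app aq y).
  by rewrite scaleNr opprK killingZr mulrCA mulVf// mulr1.
have Ht : is_coroot aq ((2 / killing t t) *: t) by exists t.
have := Hlam _ _ Ht; rewrite eqxx => lamt.
exists x, z; split; rewrite ?gr_grade.
- exact: (rootspace_grade xr).
- by apply: (rootspace_grade zr); rewrite linearN /= degq mulrNz.
rewrite brC -scaleN1r dchar_csa; last by rewrite memvZ.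
(* If [lam] vanished on [z, x], it would vanish on t and on all its multiples, including the coroot,
   where it is 1. *)
apply: contra_eq_neq lamt; rewrite linearZ /= => /eqP.
rewrite [_ *: _ == 0]mulf_eq0 oppr_eq0 oner_eq0 /= => /eqP l0.
by rewrite !linearZ /= l0 ![_ *: 0]mulr0 eq_sym oner_eq0.
Qed.

Lemma gr_gt2_eq0 (j : int) : quasi_heisenberg p -> (2 < `|j|)%N -> gr p j = 0%VS.
Proof.
have [b [w [wt [bb bw wtE bE]]]] := weighted_basis.
move=> qh; rewrite gr_grade; apply: (grade_gt2_eq0 bb bE Knd gr0_center).
  by rewrite -gr_grade gr1_neq0.
exact: gr1_nil.
Qed.

Lemma killing_gr_nondeg j x : x \in gr p j ->
  (forall y, y \in gr p (- j) -> killing x y = 0) -> x = 0.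
Proof.
have [b [w [wt [bb bw wtE bE]]]] := weighted_basis.
rewrite !gr_grade; exact: (killing_grade_nondeg bb bE Knd).
Qed.

Lemma gr_N1_irreducible (W : {vspace g}) : (W <= gr p (-1))%VS ->
  (forall z x, z \in levi p -> x \in W -> br z x \in W) -> W != 0%VS -> W = gr p (-1).
Proof.
have [b [w [wt [bb bw wtE bE]]]] := weighted_basis.
rewrite levi_gr0 !gr_grade.
exact: (grade_N1_irreducible bb bE Knd gr0_center).
Qed.

Hypothesis qh : quasi_heisenberg p.

Lemma gr_decomp x : exists f : int -> g, (forall j, f j \in gr p j) /\
  x = f (-2) + f (-1) + f 0 + f 1 + f 2.
Proof.
have [b [w [wt [bb bw wtE bE]]]] := weighted_basis.
exists (fun j => gproj b wt j x); split=> [j|].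
  by rewrite gr_grade; exact: gproj_grade bE _ _.
have fj j : j \notin [:: -2; -1; 0; 1; 2] -> gproj b wt j x = 0.
  move=> jn; have := gproj_grade bE j x.
  rewrite -gr_grade gr_gt2_eq0// ?memv0 => [/eqP//|].
  by move: jn; rewrite !inE; lia.
rewrite {1}(gproj_sum_seq wt bb x).
transitivity (\sum_(j <- [:: -2; -1; 0; 1; 2]) gproj b wt j x); last first.
  by rewrite !big_cons big_nil addr0 !addrA.
set s := undup _; rewrite (bigID [in [:: -2; -1; 0; 1; 2 : int]]) /=.
rewrite [X in _ + X]big1 ?addr0; last by move=> j; exact: fj.
rewrite [RHS](bigID [in s]) /= [X in _ + X]big1 ?addr0; last first.
  move=> j js; rewrite /gproj big1// => l /eqP wl; case/negP: js.
  by rewrite mem_undup -wl; apply/mapP; exists l; rewrite ?mem_enum.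
rewrite -big_filter -[RHS]big_filter; apply: perm_big; apply: uniq_perm.
- exact/filter_uniq/undup_uniq.
- exact/filter_uniq.
- by move=> j; rewrite !mem_filter andbC.
Qed.

Lemma par_gr : par p = (gr p 0 + gr p 1 + gr p 2)%VS.
Proof.
rewrite /par levi_gr0; apply/eqP; rewrite eqEsubv; apply/andP; split; last first.
  have n1 := gr_nilrad (ltr01 : 0 < 1 :> int); have n2 := gr_nilrad (ltr0n _ 2 : 0 < 2 :> int).
  move: (gr p 0) (gr p 1) (gr p 2) n1 n2 => G0 G1 G2 n1 n2.
  by rewrite -addvA addvS// subv_add n1.
rewrite -addvA addvS//.
apply: rootspace_sum_sub => a ar /andP[/forallP pa na].
have := pa (simple_q p); move: na; rewrite levi_rootE.
have [j dj] := deg_root ar; rewrite dj intr_eq0 ler0z => jn0 j0.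
have aj : (rootspace a <= gr p j)%VS.
  by apply/subvP => x xr; rewrite gr_grade; apply: (rootspace_grade xr).
apply: (subv_trans aj); have [j2|j2] := leqP `|j| 2; last first.
  by rewrite gr_gt2_eq0// sub0v.
have [->|->] : j = 1 \/ j = 2 by lia.
- exact: addvSl.
- exact: addvSr.
Qed.

Lemma cap_par_nilbar : (par p :&: nilbar p)%VS = 0%VS.
Proof.
have [b [w [wt [bb bw wtE bE]]]] := weighted_basis.
have gr_coord j l : wt l != j -> (gr p j <= lker (coordf b l))%VS.
  move=> lj; apply/subvP => x; rewrite gr_grade => xj.
  by rewrite memv_ker coordfE; apply/eqP/(coord_grade bb bE xj lj).
apply/eqP; rewrite -subv0; apply/subvP => x /memv_capP[xp xn].
rewrite memv0 (coord_basis bb (memvf x)) big1// => l _.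
suff : x \in lker (coordf b l) by rewrite memv_ker coordfE => /eqP->; rewrite scale0r.
have [l0|l0] := ltP (wt l) 0.
  have [h0 h1 h2] : [/\ (gr p 0 <= lker (coordf b l))%VS,
      (gr p 1 <= lker (coordf b l))%VS & (gr p 2 <= lker (coordf b l))%VS].
    by split; apply: gr_coord; lia.
  move: xp; rewrite par_gr; apply/subvP.
  move: (gr p 0) (gr p 1) (gr p 2) h0 h1 h2 => G0 G1 G2 h0 h1 h2.
  by rewrite !subv_add h0 h1.
have [h1 h2] : (gr p (-1) <= lker (coordf b l))%VS /\ (gr p (-2) <= lker (coordf b l))%VS.
  by split; apply: gr_coord; lia.
move: xn; rewrite /nilbar; apply/subvP.
by move: (gr p (-1)) (gr p (-2)) h1 h2 => G1 G2 h1 h2; rewrite subv_add h1.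
Qed.

Lemma par_nilbar_full x : x \in (par p + nilbar p)%VS.
Proof.
have [f [fj ->]] := gr_decomp x; rewrite par_gr /nilbar -!addrA addrA addrC.
apply: memv_add; last by rewrite addrC memv_add.
by rewrite addrA !memv_add.
Qed.

Lemma par_part_id x : x \in par p -> par_part p x = x.
Proof. exact: daddv_pi_id cap_par_nilbar. Qed.

Lemma nilbar_part_id x : x \in nilbar p -> nilbar_part p x = x.
Proof. by apply: daddv_pi_id; rewrite capvC cap_par_nilbar. Qed.

Lemma par_nilbar_part x : par_part p x + nilbar_part p x = x.
Proof. exact: daddv_pi_add cap_par_nilbar (par_nilbar_full x). Qed.

Lemma gr_sub_nilbar j : j < 0 -> (gr p j <= nilbar p)%VS.
Proof.
move=> j0; have [j2|j2] := leqP `|j| 2; last by rewrite gr_gt2_eq0// sub0v.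
have [->|->] : j = -1 \/ j = -2 by lia.
- exact: addvSl.
- exact: addvSr.
Qed.

Lemma gr_sub_par j : 0 <= j -> (gr p j <= par p)%VS.
Proof.
move=> j0; rewrite par_gr; have [j2|j2] := leqP `|j| 2; last by rewrite gr_gt2_eq0// sub0v.
have [->|[->|->]] : j = 0 \/ j = 1 \/ j = 2 by lia.
- by rewrite -addvA addvSl.
- by rewrite (addvC (gr p 0)) -addvA addvSl.
- exact: addvSr.
Qed.

End ParabolicGrading.

(** * The constituent defining the Omega_1 system *)

Section TensorBracket.
Variables (F : fieldType) (g : lieAlg F).
Implicit Types (x y z u v : g) (T S : tens2 g).
Local Notation stdb := (vbasis (fullv : {vspace g})).
Local Notation n := (\dim (fullv : {vspace g})).

Lemma tens2_decomp T : T = \sum_(i < n) \sum_(j < n) T i j *: tens stdb`_i stdb`_j.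
Proof.
rewrite {1}(matrix_sum_delta T); apply: eq_bigr => i _; apply: eq_bigr => j _.
by rewrite /tens !(rVofE (vbasisP _)) trmx_delta mul_delta_mx.
Qed.

(* Restricted to g(1) (x) g(-2) this is the map tau1~, see [tpair_tau1]. *)
Definition tens_br T : g := \sum_(i < n) \sum_(j < n) T i j *: br stdb`_j stdb`_i.

Lemma tens_br_linear : linear tens_br.
Proof.
move=> a T S; rewrite /tens_br scaler_sumr -big_split; apply: eq_bigr => i _ /=.
rewrite scaler_sumr -big_split; apply: eq_bigr => j _ /=.
by rewrite !mxE scalerDl scalerA.
Qed.

HB.instance Definition _ := GRing.isLinear.Build F (tens2 g) g _ tens_br tens_br_linear.

Lemma tens_br_tens u v : tens_br (tens u v) = br v u.
Proof.
rewrite /tens_br {2}(coord_vbasis (memvf u)) br_sumr; apply: eq_bigr => i _.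
rewrite {2}(coord_vbasis (memvf v)) br_suml; apply: eq_bigr => j _.
by rewrite /tens brZr brZl scalerA !mxE big_ord1 !mxE.
Qed.

(** Equivariance of tau1~; on pure tensors it is the Jacobi identity. *)
Lemma tens_br_ad x T : tens_br (adl x T + adr x T) = br x (tens_br T).
Proof.
have L : linear (fun T => tens_br (adl x T + adr x T)).
  move=> a T1 T2; rewrite /adl /adr !linearP /= mulmxDl -scalemxAl.
  by rewrite addrACA -scalerDr linearP.
pose fM := GRing.isLinear.Build F (tens2 g) g _ _ L.
pose fL : {linear tens2 g -> g} := HB.pack (fun T => tens_br (adl x T + adr x T)) fM.
rewrite -[LHS]/(fL T) (tens2_decomp T) !linear_sum br_sumr; apply: eq_bigr => i _.
rewrite !linear_sum br_sumr; apply: eq_bigr => j _.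
rewrite !linearZ brZr; congr (_ *: _).
rewrite /fL /= adl_tens adr_tens linearD /= !tens_br_tens.
by rewrite [RHS]br_brr addrC.
Qed.

Lemma tpair_linearl S : linear (fun T => tpair T S : F^o).
Proof.
move=> a T1 T2; rewrite /tpair !linearP /= !mulmxDl -!scalemxAl.
by rewrite mxtraceD mxtraceZ.
Qed.

Lemma tpair_tens_suml u v (m : nat) (X1 X2 : 'I_m -> g) :
  tpair (tens u v) (\sum_(k < m) tens (X1 k) (X2 k)) =
  \sum_(k < m) killing u (X1 k) * killing v (X2 k).
Proof.
have L : linear (fun S => tpair (tens u v) S : F^o).
  move=> a T1 T2; rewrite /tpair !linearP /= !mulmxDl -!scalemxAl.
  by rewrite mxtraceD mxtraceZ.
pose fM := GRing.isLinear.Build F (tens2 g) F^o _ _ L.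
pose fL : {linear tens2 g -> F^o} := HB.pack (fun S => tpair (tens u v) S : F^o) fM.
rewrite -[LHS]/(fL _) linear_sum; apply: eq_bigr => k _.
exact: tpair_tens.
Qed.

End TensorBracket.

Section Omega1.
Variables (R : realType) (g : lieAlg R[i]%C) (p : maxParabolic g).

(** For Y the tensor of u and v both sides equal killing(u, [x, v]), because the dual bases in omega
    satisfy sum_i killing(v, X_i) Xs_i = v for v in g(-2). *)
Lemma tpair_tau1 (w Y : tens2 g) (x : g) : is_omega p w ->
  Y \in tensv (gr p 1) (gr p (-2)) -> tpair Y (tau1 w x) = killing (tens_br Y) x.
Proof.
move=> [k [X [Xs [_ bXs dual ->]]]] YT.
pose S := tau1 (\sum_(i < k) tens Xs`_i X`_i) x.
pose f T := tpair T S - killing (tens_br T) x : (R[i]%C)^o.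
have L : linear f.
  move=> a T1 T2; rewrite /f (tpair_linearl S) linearP killingDl killingZl scalerBr.
  by rewrite opprD addrACA.
pose fM := GRing.isLinear.Build _ (tens2 g) (R[i]%C)^o _ _ L.
pose fL : {linear tens2 g -> (R[i]%C)^o} := HB.pack f fM.
suff H : (tensv (gr p 1) (gr p (-2)) <= lker (linfun fL))%VS.
  by move/(subvP H): YT; rewrite memv_ker lfunE subr_eq0 => /eqP.
apply/span_subvP => _ /allpairsP[uv [/vbasis_mem ug /vbasis_mem vg ->]].
rewrite memv_ker lfunE subr_eq0; case: uv ug vg => u v /= ug vg.
rewrite tens_br_tens /S /tau1.
have -> : adl x (\sum_(i < k) tens Xs`_i X`_i) = \sum_(i < k) tens (br x Xs`_i) X`_i.
  by rewrite /adl mulmx_sumr; apply: eq_bigr => i _; rewrite -adl_tens.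
rewrite tpair_tens_suml brC killingNl killing_br (brC v) killingNr opprK.
rewrite {2}(coord_basis bXs vg) br_sumr killing_sum_r; apply/eqP/eq_bigr => i _.
rewrite brZr killingZr mulrC; congr (_ * _).
rewrite {1}(coord_basis bXs vg) killing_sum_l (bigD1 i)//= killingZl dual eqxx mulr1.
by rewrite big1 ?addr0// => j ji; rewrite killingZl dual (negPf ji) mulr0.
Qed.

Hypothesis Knd1 : forall x, x \in gr p (-1) -> (forall y, y \in gr p 1 -> killing x y = 0) -> x = 0.
Hypothesis gr_br : forall i j x y, x \in gr p i -> y \in gr p j -> br x y \in gr p (i + j).
Hypothesis irr1 : forall W : {vspace g}, (W <= gr p (-1))%VS ->
  (forall z x, z \in levi p -> x \in W -> br z x \in W) -> W != 0%VS -> W = gr p (-1).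

(** Schur's argument. The kernel of [tens_br] on V is a submodule, different from V because of the
    nonzero pairing, so [tens_br] is injective on V; its image is a nonzero submodule of the
    irreducible g(-1). The Z_i are the images of the basis Y. *)
Lemma Omega1_basis w V m (Y : m.-tuple (tens2 g)) (Z : m.-tuple g) :
  is_omega p w -> special_constituent p w V -> basis_of V Y ->
  (forall i : 'I_m, is_ttau1 p w Y`_i Z`_i) -> basis_of (gr p (-1)) Z.
Proof.
move=> om [[VT Vst V0 Virr] [Y0 [x0 [Y0V x0g Y0x0]]]] bY HZ.
have tbg T : T \in V -> tens_br T \in gr p (-1).
  move=> /(subvP VT) TT.
  have H : (tensv (gr p 1) (gr p (-2)) <= linfun (@tens_br _ g) @^-1: gr p (-1))%VS.
    apply/span_subvP => _ /allpairsP[[u v] [/= /vbasis_mem ug /vbasis_mem vg ->]].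
    by rewrite -memv_preim lfunE /= tens_br_tens (_ : -1 = -2 + 1)// gr_br.
  by move/(subvP H): TT; rewrite -memv_preim lfunE.
have YV (i : 'I_m) : Y`_i \in V.
  by rewrite (basis_mem bY)// mem_nth ?size_tuple.
have ZE (i : 'I_m) : Z`_i = tens_br Y`_i.
  have [Zg HZi] := HZ i.
  apply/eqP; rewrite -subr_eq0; apply/eqP/Knd1; first by rewrite rpredB ?tbg.
  move=> y yg; rewrite killingDl killingNl HZi// tpair_tau1 ?subrr//.
  exact: (subvP VT).
have sumE (c : 'I_m -> R[i]%C) :
    \sum_(i < m) c i *: Z`_i = tens_br (\sum_(i < m) c i *: Y`_i).
  by rewrite linear_sum; apply: eq_bigr => i _; rewrite linearZ ZE.
pose K := (V :&: lker (linfun (@tens_br _ g)))%VS.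
have Kst : levi_stable p K.
  move=> x T xl /memv_capP[TV]; rewrite memv_ker lfunE => /eqP T0.
  apply/memv_capP; split; first exact: Vst.
  by rewrite memv_ker lfunE /= tens_br_ad [tens_br T]T0 br0r.
have K0 : K = 0%VS.
  case: (Virr K _ Kst); [exact: capvSl|by []|] => KV.
  move: (Y0V); rewrite -KV => /memv_capP[_]; rewrite memv_ker lfunE => /eqP T0.
  by case: Y0x0; rewrite tpair_tau1// ?[tens_br Y0]T0 ?killing0l// (subvP VT).
have Zf : free Z.
  apply/freeP => c; rewrite sumE => c0.
  have : \sum_(i < m) c i *: Y`_i \in K.
    apply/memv_capP; split; last by rewrite memv_ker lfunE /= c0.
    by apply: memv_suml => i _; rewrite memvZ.
  by rewrite K0 memv0 => /eqP; move/freeP: (basis_free bY); apply.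
rewrite /basis_of Zf andbT; apply/eqP; apply: irr1.
- apply/span_subvP => _ /tnthP[i ->]; rewrite (tnth_nth 0) ZE; exact/tbg/YV.
- move=> z x zl /coord_span ->.
  rewrite sumE -tens_br_ad; set T := \sum_i _.
  have TV : adl z T + adr z T \in V.
    by apply: Vst => //; apply: memv_suml => i _; rewrite memvZ.
  rewrite (coord_basis bY TV) -sumE; apply: memv_suml => i _; rewrite memvZ//.
  by rewrite memv_span// mem_nth ?size_tuple.
apply/eqP => Z0; apply: Y0x0; rewrite tpair_tau1//; last exact: (subvP VT).
suff : tens_br Y0 \in <<Z>>%VS by rewrite Z0 memv0 => /eqP->; rewrite killing0l.
rewrite (coord_basis bY Y0V) -sumE; apply: memv_suml => i _; rewrite memvZ//.
by rewrite memv_span// mem_nth ?size_tuple.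
Qed.

End Omega1.

(** * The exponential of ad *)

(* Reduces identities between vectors to ones that [ring] and [field] can solve. *)
Lemma scalar_ext (F : fieldType) (vT : vectType F) (u v : vT) :
  (forall f : vT -> F, {morph f : x y / x + y} -> {morph f : x / - x} ->
     (forall a x, f (a *: x) = a * f x) -> f u = f v) -> u = v.
Proof.
move=> H; rewrite (coord_vbasis (memvf u)) (coord_vbasis (memvf v)).
apply: eq_bigr => i _; congr (_ *: _); apply: H.
- by move=> x y; rewrite linearD.
- by move=> x; rewrite linearN.
- by move=> a x; rewrite linearZ.
Qed.

Section AdExponential.
Variables (F : numFieldType) (g : lieAlg F).

Definition ad_term (a x : g) k : g := (k`!%:R)^-1 *: iter k (br a) x.

Lemma br_ad_term a x k : br a (ad_term a x k) = k.+1%:R *: ad_term a x k.+1.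
Proof.
by rewrite /ad_term brZr scalerA factS natrM invfM mulrA mulfV ?mul1r ?pnatr_eq0.
Qed.

Variables (a z : g) (T : nat -> g).
Hypothesis aaz : br a (br a z) = 0.
Hypothesis aT : forall k, br a (T k) = k.+1%:R *: T k.+1.

(* For [T := ad_term a x] this is the derivative of [ad_term a x k] as a moves
   with velocity -(z - [a, z] / 2). *)
Fixpoint dad_term k : g := if k is k'.+1 then
  k'.+1%:R^-1 *: (br (- (z - 2^-1 *: br a z)) (T k') + br a (dad_term k'))
  else 0.

Definition prev_term k := if k is k'.+1 then T k' else 0.

(** ad [a, z] commutes with ad a because [a, [a, z]] = 0, so the recursion closes with three terms.
    The last one for k cancels the middle one for k + 1 upon summation. *)
Lemma dad_termS k : dad_term k.+1 =
  - br z (T k) - 2^-1 *: br (br a z) (prev_term k) + 2^-1 *: br (br a z) (T k).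
Proof.
elim: k => [|k IH].
  by rewrite /= invr1 scale1r br0r addr0 br0r scaler0 subr0 brNl brDl brNl brZl opprB addrC.
rewrite [LHS]/= -/(dad_term k.+1) IH /prev_term -/(prev_term k).
rewrite !(brDr, brNr, brZr) (br_brr a z). rewrite aT.
rewrite (br_brr a (br a z) (T k)) aaz br0l add0r aT.
have -> : br a (br (br a z) (prev_term k)) = k%:R *: br (br a z) (T k).
  rewrite br_brr aaz br0l add0r; case: k {IH} => [|k].
    by rewrite br0r br0r scale0r.
  by rewrite /= aT brZr.
rewrite !(brNl, brDl, brZl, brZr).
set B := br z _; set C := br _ (T k.+1); set D := br _ (T k).
apply: scalar_ext => f fD fN fZ; rewrite !(fD, fN, fZ).
have k2 : (k.+2%:R : F) = k%:R + 2 by rewrite -addn2 natrD.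
have k1 : (k.+1%:R : F) = k%:R + 1 by rewrite -addn1 natrD.
have nz : (k%:R + 2 : F) != 0 by rewrite -k2 pnatr_eq0.
rewrite k2 k1. field.
by rewrite nz.
Qed.

(** The terms in [a, z] telescope to [[a, z], T 3] / 2, which vanishes, and [z, T 4] = 0 completes
    the sum on the right. *)
Lemma sum_dad_term : br z (T 4) = 0 -> br (br a z) (T 3) = 0 ->
  \sum_(k < 5) dad_term k = - br z (\sum_(k < 5) T k).
Proof.
move=> z4 az3.
rewrite big_ord_recl [dad_term _]/= add0r.
under eq_bigr do rewrite dad_termS.
rewrite !big_ord_recr !big_ord0 /= !add0r az3 br0r !(brDr, brNr, brZr) z4 !addr0.
set B0 := br z (T 0); set B1 := br z (T 1); set B2 := br z (T 2).
set B3 := br z (T 3); set C0 := br _ (T 0); set C1 := br _ (T 1).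
set C2 := br _ (T 2).
by apply: scalar_ext => f fD fN fZ; rewrite !(fD, fN, fZ); ring.
Qed.

End AdExponential.

(** * Lie-algebra-valued functions *)

Section LieValued.
Local Open Scope complex_scope.
Variables (R : realType) (g : lieAlg R[i]) (d : nat) (e : d.-tuple g).
Local Notation fn := ('rV[R]_d -> R[i]).
Local Notation gdual := 'Hom(g, R[i]^o).
Implicit Types (x : 'rV[R]_d) (G : 'rV[R]_d -> g) (c : 'I_d -> fn).

(* Smoothness and derivatives of functions into g are tested on linear forms. *)
Definition gsmooth G := forall f : gdual, smooth (fun x => f (G x) : R[i]).

Definition gderiv c x G (V : g) :=
  gsmooth G /\ forall f : gdual, vfield c (fun y => f (G y) : R[i]) x = f V.

(** The derivative of [pt] at x along the vector field c. *)
Definition velocity c x : g := \sum_k c k x *: e`_k.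

Lemma gderiv_cst c x (X : g) : gderiv c x (fun=> X) 0.
Proof.
split=> f; first exact: smooth_cst.
by rewrite vfield_cst linear0.
Qed.

Lemma gderivD c x G1 G2 V1 V2 : gderiv c x G1 V1 -> gderiv c x G2 V2 ->
  gderiv c x (fun y => G1 y + G2 y) (V1 + V2).
Proof.
move=> [s1 d1] [s2 d2].
have E (f : gdual) : (fun y => f (G1 y + G2 y) : R[i]) = (fun y => (f (G1 y) : R[i]) + f (G2 y)).
  by apply/funext => y; rewrite linearD.
split=> f; rewrite E; first exact: smoothD.
by rewrite vfieldD// d1 d2 linearD.
Qed.

Lemma gderivZ c x G V a : gderiv c x G V -> gderiv c x (fun y => a *: G y) (a *: V).
Proof.
move=> [s1 d1].
have E (f : gdual) : (fun y => f (a *: G y) : R[i]) = (fun y => a * (f (G y) : R[i])).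
  by apply/funext => y; rewrite linearZ.
split=> f; rewrite E; first exact: smoothZ.
by rewrite vfieldZ// d1 linearZ.
Qed.

Lemma gderiv_lin c x G V (h : 'End(g)) : gderiv c x G V -> gderiv c x (fun y => h (G y)) (h V).
Proof.
move=> [s1 d1].
have E (f : gdual) : (fun y => f (h (G y)) : R[i]) = (fun y => (f \o h)%VF (G y) : R[i]).
  by apply/funext => y; rewrite comp_lfunE.
split=> f; rewrite E; first exact: s1.
by rewrite d1 comp_lfunE.
Qed.

Lemma gderiv_sum c x (n : nat) (G : 'I_n -> 'rV[R]_d -> g) V :
  (forall k, gderiv c x (G k) (V k)) ->
  gderiv c x (fun y => \sum_k G k y) (\sum_k V k).
Proof.
move=> H.
have E (f : gdual) : (fun y => f (\sum_k G k y) : R[i]) = (fun y => \sum_k (f (G k y) : R[i])).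
  by apply/funext => y; rewrite linear_sum.
split=> f; rewrite E; first by apply: smooth_sum => k; case: (H k).
rewrite vfield_sum ?linear_sum; last by move=> k; case: (H k).
by apply: eq_bigr => k _; case: (H k).
Qed.

Lemma gderiv_br_pt c x G V : gderiv c x G V ->
  gderiv c x (fun y => br (pt e y) (G y)) (br (velocity c x) (G x) + br (pt e x) V).
Proof.
move=> [s1 d1].
have E (f : gdual) : (fun y => f (br (pt e y) (G y)) : R[i]) =
    (fun y => \sum_(k < d) (y 0 k)%:C * ((f \o ad e`_k)%VF (G y) : R[i])).
  apply/funext => y; rewrite /pt br_suml linear_sum; apply: eq_bigr => k _.
  by rewrite brZl linearZ comp_lfunE adE.
split=> f; rewrite E.
  by apply: smooth_sum => k; apply: smoothM; [exact: smooth_coord|exact: s1].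
rewrite vfield_sum; last by move=> k; apply: smoothM; [exact: smooth_coord|exact: s1].
rewrite linearD /= /velocity /pt !br_suml !linear_sum -big_split.
apply: eq_bigr => k _.
rewrite vfieldM; [|exact: smooth_coord|exact: s1].
by rewrite d1 vfield_coord !comp_lfunE !adE !brZl !linearZ /= addrC [X in _ + X]mulrC.
Qed.

Lemma gderiv_ext c x G1 G2 V1 V2 : (forall y, G1 y = G2 y) -> V1 = V2 ->
  gderiv c x G1 V1 -> gderiv c x G2 V2.
Proof. by move=> /funext -> ->. Qed.

Lemma gderivN c x G V : gderiv c x G V -> gderiv c x (fun y => - G y) (- V).
Proof.
move=> H; apply: (gderiv_ext _ _ (gderivZ (-1) H)) => [y|]; exact: scaleN1r.
Qed.

(** The assumed velocity is that of the curve exp(pt x) exp(t z), so this differentiates Ad(n^-1) X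
    under right translation of n. With a = - [pt e x] the exponential series is differentiated term
    by term, [dad_term] giving the derivatives. *)
Lemma gderiv_Ad_exp c x (X z : g) :
  velocity c x = z + 2^-1 *: br (pt e x) z ->
  br (pt e x) (br (pt e x) z) = 0 ->
  br z (iter 4 (br (pt e x)) X) = 0 ->
  br (br (pt e x) z) (iter 3 (br (pt e x)) X) = 0 ->
  gderiv c x (fun y => Ad_exp (- pt e y) X) (- br z (Ad_exp (- pt e x) X)).
Proof.
move=> cV xxz r4 r3.
have iterN (a : g) k : iter k (br (- a)) X = (-1) ^+ k *: iter k (br a) X.
  by elim: k => [|k IH]; rewrite ?expr0 ?scale1r//= IH brZr brNl scalerN exprS mulN1r scaleNr.
have aaz : br (- pt e x) (br (- pt e x) z) = 0 by rewrite !(brNl, brNr) xxz !oppr0.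
have T4 : br z (ad_term (- pt e x) X 4) = 0.
  by rewrite /ad_term iterN !brZr r4 !scaler0.
have T3 : br (br (- pt e x) z) (ad_term (- pt e x) X 3) = 0.
  by rewrite /ad_term iterN !brNl !brZr r3 !scaler0 oppr0.
have := sum_dad_term aaz (br_ad_term (- pt e x) X) T4 T3.
rewrite /Ad_exp /ad_term => <-.
apply: gderiv_sum => -[k /= _]; elim: k => [|k IH].
  by rewrite /=; apply: gderiv_cst.
have H := gderivZ (k.+1%:R^-1) (gderivN (gderiv_br_pt IH)).
apply: gderiv_ext H => [y|] /=.
  by rewrite factS natrM invfM -scalerA brZr brNl !scalerN.
congr (_ *: _); rewrite opprD -!brNl cV; congr (br _ _ + _).
by rewrite brNl scalerN opprK.
Qed.

End LieValued.

(** * Real forms and their real bases *)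

Section RealBasis.
Local Open Scope complex_scope.
Variables (R : realType) (g : lieAlg R[i]).
Implicit Types (S : set g) (U : {vspace g}).

Lemma real_basis_complex S U d (e : d.-tuple g) :
  real_form_of S U -> real_basis S e -> basis_of U e.
Proof.
move=> [SU S0 Slin Sdec Scap] [Se Suniq].
have Ssum (c : 'I_d -> R) : S (\sum_(i < d) (c i)%:C *: e`_i).
  apply: big_ind => //.
    move=> x y Sx Sy; rewrite -[x]scale1r; exact: (Slin 1).
  by move=> i _; rewrite -[_ *: _]addr0; exact: Slin.
have zero (c : 'I_d -> R) : \sum_(i < d) (c i)%:C *: e`_i = 0 -> forall i, c i = 0.
  move=> c0 i; have [c' [_ Hc']] := Suniq 0 S0.
  have E1 : c' = \row_i c i.
    by apply: Hc'; rewrite -[LHS]c0; apply: eq_bigr => j _; rewrite mxE.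
  have E2 : c' = 0.
    by apply: Hc'; apply/esym/big1 => j _; rewrite mxE scale0r.
  by move/rowP/(_ i): E1; rewrite E2 !mxE.
have Sspan y : S y -> y \in <<e>>%VS.
  move=> /Suniq[c [-> _]]; apply: memv_suml => i _; rewrite memvZ//.
  by rewrite memv_span// mem_nth ?size_tuple.
apply/andP; split.
  rewrite eqEsubv; apply/andP; split.
    apply/span_subvP => _ /tnthP[i ->]; rewrite (tnth_nth 0); exact/SU/Se.
  apply/subvP => x xU; have [a [b [Sa Sb ->]]] := Sdec x xU.
  by apply: rpredD; [|apply: rpredZ]; exact: Sspan.
apply/freeP => k k0.
(* Real and imaginary parts of a complex relation: u + i v = 0 with u and v in S puts i v in S, so v
   = 0 and then u = 0. *)
pose u := \sum_(i < d) (complex.Re (k i))%:C *: e`_i.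
pose v := \sum_(i < d) (complex.Im (k i))%:C *: e`_i.
have uv : u + 'i *: v = 0.
  rewrite -k0 scaler_sumr -big_split; apply: eq_bigr => i _ /=.
  by rewrite scalerA -scalerDl -complexE.
have v0 : v = 0.
  apply: Scap; first exact: Ssum.
  have -> : 'i *: v = (-1)%:C *: u + 0.
    rewrite addr0 rmorphN rmorph1 scaleN1r; apply/eqP.
    by rewrite -addr_eq0 addrC; apply/eqP.
  by apply: Slin => //; exact: Ssum.
have u0 : u = 0.
  by move: uv; rewrite v0 scaler0 addr0.
move=> i; rewrite (complexE (k i)) (zero _ u0 i) (zero _ v0 i).
by rewrite mulr0 addr0.
Qed.

Lemma coord_real_basis S U d (e : d.-tuple g) k x : basis_of U e ->
  real_basis S e -> S x -> coord e k x \is Num.real.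
Proof.
move=> eb [_ Suniq] /Suniq[c [-> _]].
by rewrite coord_sum_free ?(basis_free eb)//; apply/complex_realP; eexists.
Qed.

End RealBasis.

(** * The line bundle *)

Section BundleCalculus.
Local Open Scope complex_scope.
Variables (R : realType) (g : lieAlg R[i]) (p : maxParabolic g).
Local Notation gdual := 'Hom(g, R[i]^o).
Implicit Types (X Z a z : g).

Hypothesis Knd : forall X : g, (forall Z, killing X Z = 0) -> X = 0.
Hypothesis qh : quasi_heisenberg p.

(** Elements of nbar are not homogeneous, so vanishing for reasons of degree is expressed through
    the filtration by degree at most m, which they lower by 1. *)
Definition gr_filt (m : int) : {vspace g} :=
  (\sum_(j <- [:: -2; -1; 0; 1; 2 : int]%R | (j <= m)%R) gr p j)%VS.

Lemma gr_filt_sup j m : j <= m -> (gr p j <= gr_filt m)%VS.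
Proof.
move=> jm; have [j2|j2] := leqP `|j| 2; last by rewrite gr_gt2_eq0// sub0v.
have jin : j \in [:: -2; -1; 0; 1; 2 : int] by rewrite !inE; lia.
by rewrite /gr_filt (big_rem j)//= jm addvSl.
Qed.

Lemma gr_filt_subP m (U : {vspace g}) :
  (forall j, j <= m -> (gr p j <= U)%VS) -> (gr_filt m <= U)%VS.
Proof.
move=> H; rewrite /gr_filt; apply: (big_ind (fun V => (V <= U)%VS)) => //.
  exact: sub0v.
by move=> U1 U2 s1 s2; rewrite subv_add s1.
Qed.

Lemma br_gr_filt (j m : int) a X : a \in gr p j -> X \in gr_filt m -> br a X \in gr_filt (m + j).
Proof.
move=> aj; suff H : (gr_filt m <= ad a @^-1: gr_filt (m + j))%VS.
  by move=> /(subvP H); rewrite -memv_preim adE.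
apply: gr_filt_subP => i im; apply/subvP => Z Zi; rewrite -memv_preim adE.
by apply: (subvP (gr_filt_sup _)) (gr_br aj Zi); lia.
Qed.

Lemma gr_filtW m m' : m <= m' -> (gr_filt m <= gr_filt m')%VS.
Proof. by move=> mm; apply: gr_filt_subP => j jm; apply: gr_filt_sup; lia. Qed.

Lemma nilbar_gr_filt (m : int) a X : a \in nilbar p -> X \in gr_filt m ->
  br a X \in gr_filt (m - 1).
Proof.
move=> /memv_addP[a1 a1g [a2 a2g ->]] Xm; rewrite brDl rpredD//.
  exact: br_gr_filt a1g Xm.
by apply: (subvP (gr_filtW _)) (br_gr_filt a2g Xm); lia.
Qed.

Lemma gr_filt_full X : X \in gr_filt 2.
Proof.
have [F [FG ->]] := gr_decomp Knd qh X.
by do ![apply: rpredD]; apply: (subvP (gr_filt_sup _)) (FG _).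
Qed.

Lemma gr_filt0 m X : m < -2 -> X \in gr_filt m -> X = 0.
Proof.
move=> m2 Xm; apply/eqP; rewrite -memv0; apply: (subvP _ X Xm).
by apply: gr_filt_subP => j jm; rewrite gr_gt2_eq0 ?subvv//; lia.
Qed.

Lemma nilbar_br a z : a \in nilbar p -> z \in nilbar p -> br a z \in gr p (-2).
Proof.
move=> /memv_addP[a1 a1g [a2 a2g ->]] /memv_addP[z1 z1g [z2 z2g ->]].
have nul (i j : int) X Z : X \in gr p i -> Z \in gr p j -> i + j < -2 -> br X Z = 0.
  move=> Xi Zj ij; apply/eqP; rewrite -memv0 -(gr_gt2_eq0 Knd (j := i + j) qh); first exact: gr_br.
  by lia.
rewrite brDl !brDr (nul _ _ _ _ a1g z2g)// (nul _ _ _ _ a2g z1g)// (nul _ _ _ _ a2g z2g)//.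
by rewrite !addr0 (gr_br a1g z1g).
Qed.

Lemma gr_N2_nilbar a : a \in gr p (-2) -> a \in nilbar p.
Proof. exact/subvP/gr_sub_nilbar. Qed.

Lemma nilbar_br_N2 a z : a \in nilbar p -> z \in gr p (-2) -> br a z = 0.
Proof.
move=> an z2; apply: (@gr_filt0 (-3)) => //.
exact: nilbar_gr_filt an (subvP (gr_filt_sup (lexx _)) _ z2).
Qed.

Lemma N2_br_nilbar a z : a \in gr p (-2) -> z \in nilbar p -> br a z = 0.
Proof. by move=> a2 zn; rewrite brC nilbar_br_N2// oppr0. Qed.

Variables (d : nat) (e : d.-tuple g).
Local Notation fn := ('rV[R]_d -> R[i]).
Implicit Types (x y : 'rV[R]_d) (f : fn).
Hypothesis eb : basis_of (nilbar p) e.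
Hypothesis ereal : forall i j k : 'I_d, coord e k (br e`_i e`_j) \is Num.real.

Lemma e_nilbar (i : 'I_d) : e`_i \in nilbar p.
Proof. by rewrite (basis_mem eb)// mem_nth ?size_tuple. Qed.

Lemma pt_nilbar x : pt e x \in nilbar p.
Proof. by apply: memv_suml => i _; rewrite memvZ// e_nilbar. Qed.

Lemma iter_gr_filt k x X : iter k (br (pt e x)) X \in gr_filt (2 - k%:Z).
Proof.
elim: k => [|k IH]; first by rewrite subr0 gr_filt_full.
apply: (subvP (gr_filtW _)) (nilbar_gr_filt (pt_nilbar x) IH); lia.
Qed.

(* The coefficients of R(G) in the coordinates [pt]: by the product formula
   [nmul], exp (pt y) exp (t Z) moves with velocity Z + [pt y, Z] / 2. *)
Definition rfield (G : 'rV[R]_d -> g) (k : 'I_d) : fn :=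
  fun y => coord e k (G y + 2^-1 *: br (pt e y) (G y)).

Lemma velocity_rfield G x : G x \in nilbar p ->
  velocity e (rfield G) x = G x + 2^-1 *: br (pt e x) (G x).
Proof.
move=> Gn; rewrite /velocity /rfield -(coord_basis eb)//.
by rewrite rpredD// rpredZ// gr_N2_nilbar// nilbar_br// pt_nilbar.
Qed.

Lemma gderiv_rfield c x G V k : gderiv c x G V ->
  smooth (rfield G k) /\
  vfield c (rfield G k) x = coord e k (V + 2^-1 *: (br (velocity e c x) (G x) + br (pt e x) V)).
Proof.
move=> H; have [s D] := gderivD H (gderivZ 2^-1 (gderiv_br_pt e H)).
have E y : rfield G k y = coordf e k (G y + 2^-1 *: br (pt e y) (G y)) by rewrite coordfE.
by rewrite (_ : rfield G k = fun y => coordf e k (G y + 2^-1 *: br (pt e y) (G y)));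
  [split; [exact: s|rewrite D coordfE]|exact/funext].
Qed.

Lemma smooth_rfield_cst Z k : smooth (rfield (fun=> Z) k).
Proof. by have [] := @gderiv_rfield (fun _ _ => 0) 0 _ _ k (gderiv_cst _ _ Z). Qed.

Lemma pt_delta (i : 'I_d) (t : R) : pt e (t *: delta_mx 0 i) = t%:C *: e`_i.
Proof.
rewrite /pt (bigD1 i)//= !mxE !eqxx mulr1 big1 ?addr0// => j ji.
by rewrite !mxE (negPf ji) mulr0 scale0r.
Qed.

(** [crd] keeps only real parts; the structure constants being real, nothing is lost when [nmul] is
    computed. *)
Lemma real_rfield_basis (i k : 'I_d) x : rfield (fun=> e`_i) k x \is Num.real.
Proof.
rewrite /rfield linearD linearZ /= rpredD//.
  by rewrite coord_free ?(basis_free eb)// realn.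
rewrite rpredM ?rpredV ?realn// /pt br_suml linear_sum rpred_sum// => j _.
rewrite brZl linearZ rpredM//; first by apply/complex_realP; eexists.
exact: ereal.
Qed.

(** The product formula is affine in the second factor, so right translation by exp(t e_i) moves x
    along a straight line and [Rbasis] is an ordinary directional derivative. *)
Lemma nmul_line (i : 'I_d) x (t : R) :
  nmul e x (t *: delta_mx 0 i) =
  x + t *: \row_k complex.Re (rfield (fun=> e`_i) k x).
Proof.
apply/rowP => k; rewrite /nmul !mxE pt_delta brZr.
have -> : pt e x + t%:C *: e`_i + 2^-1 *: (t%:C *: br (pt e x) e`_i) =
    pt e x + t%:C *: (e`_i + 2^-1 *: br (pt e x) e`_i).
  by rewrite -addrA scalerDr !scalerA (mulrC 2^-1).
rewrite linearD linearZ /= -/(rfield (fun=> e`_i) k x) complex_ReD.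
have -> : coord e k (pt e x) = (x 0 k)%:C by rewrite /pt coord_sum_free ?(basis_free eb).
by congr (_ + _); rewrite [LHS]complex_ReM /= mul0r subr0.
Qed.

Lemma Rbasis_vfield i f x : smooth f -> Rbasis e i f x = vfield (rfield (fun=> e`_i)) f x.
Proof.
move=> sf; rewrite /Rbasis.
under eq_fun do rewrite nmul_line.
under [X in _ +i* derive1 X _]eq_fun do rewrite nmul_line.
rewrite derive1_complex_line//; apply: eq_bigr => k _.
by rewrite mxE RRe_real// real_rfield_basis.
Qed.

(** Only the value of G at the point of evaluation enters, so the direction may vary with the point,
    as it does in [pi_s]. *)
Lemma Rdiff_vfield (G : 'rV[R]_d -> g) f x : G x \in nilbar p -> smooth f ->
  Rdiff e (G x) f x = vfield (rfield G) f x.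
Proof.
move=> Gn sf; rewrite /Rdiff.
under eq_bigr do rewrite Rbasis_vfield// mulr_sumr.
rewrite exchange_big /=; apply: eq_bigr => k _.
under eq_bigr do rewrite mulrA.
rewrite -mulr_suml; congr (_ * _).
have EZ := coord_basis eb Gn.
have -> : rfield G k x =
    coord e k (\sum_i coord e i (G x) *: (e`_i + 2^-1 *: br (pt e x) e`_i)).
  rewrite /rfield; congr (coord e k _).
  under eq_bigr do rewrite scalerDr.
  rewrite big_split /= -EZ; congr (_ + _); rewrite [in LHS]EZ br_sumr scaler_sumr.
  by apply: eq_bigr => i _; rewrite brZr !scalerA mulrC.
by rewrite linear_sum; apply: eq_bigr => i _; rewrite linearZ.
Qed.

Lemma RdiffZ_sum (m : nat) (c : 'I_m -> R[i]) (Z : 'I_m -> g) f x :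
  Rdiff e (\sum_l c l *: Z l) f x = \sum_l c l * Rdiff e (Z l) f x.
Proof.
rewrite /Rdiff; under [RHS]eq_bigr do rewrite mulr_sumr.
rewrite exchange_big /=; apply: eq_bigr => i _.
rewrite linear_sum mulr_suml; apply: eq_bigr => l _.
by rewrite linearZ mulrA.
Qed.

(** The nilpotency conditions of [gderiv_Ad_exp] are degree counts: z after four lowerings of X, and
    [pt x, z] after three, both end in degree at most -3. *)
Lemma gderiv_Ad c x X z : z \in nilbar p ->
  velocity e c x = z + 2^-1 *: br (pt e x) z ->
  gderiv c x (fun y => Ad_exp (- pt e y) X) (- br z (Ad_exp (- pt e x) X)).
Proof.
move=> zn cV; apply: gderiv_Ad_exp => //.
- by rewrite nilbar_br_N2 ?pt_nilbar// nilbar_br// pt_nilbar.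
- apply: (@gr_filt0 (-3)) => //.
  exact: nilbar_gr_filt zn (iter_gr_filt 4 x X).
- apply: (@gr_filt0 (-3)) => //.
  exact: br_gr_filt (nilbar_br (pt_nilbar x) zn) (iter_gr_filt 3 x X).
Qed.

Lemma pt0 : pt e (0 : 'rV[R]_d) = 0.
Proof. by rewrite /pt big1// => i _; rewrite mxE scale0r. Qed.

Lemma Ad_exp0 X : Ad_exp (0 : g) X = X.
Proof.
rewrite /Ad_exp big_ord_recl /= fact0 invr1 scale1r big1 ?addr0// => k _.
by rewrite /= br0l scaler0.
Qed.

Lemma gr_N1_nilbar Z : Z \in gr p (-1) -> Z \in nilbar p.
Proof. exact/subvP/gr_sub_nilbar. Qed.

Lemma nilbar_part_in X : nilbar_part p X \in nilbar p.
Proof. exact: memv_pi. Qed.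

Lemma par_part_in X : par_part p X \in par p.
Proof. exact: memv_pi. Qed.

Lemma nilbar_part_par X : X \in par p -> nilbar_part p X = 0.
Proof.
move=> Xp; apply: (addrI (par_part p X)).
by rewrite (par_nilbar_part Knd qh) (par_part_id Knd qh)// addr0.
Qed.

Variables (lam : 'Hom(subvs_of (csa p), R[i]^o)).

(** The character term of [pi_s] packaged as a linear map, because [gsmooth] and [gderiv] are tested
    on such maps. *)
Definition charf : gdual :=
  (lam \o (linfun (vsproj (csa p)) \o
   (daddv_pi (csa p) (\sum_(a <- Defs.roots p) rootspace a)%VS \o
    daddv_pi (par p) (nilbar p))))%VF.

Lemma charfE X : charf X = dchar lam (par_part p X).
Proof. by rewrite /charf !comp_lfunE lfunE. Qed.

Lemma gsmooth_Ad X : gsmooth (fun y => Ad_exp (- pt e y) X).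
Proof.
have [] // := @gderiv_Ad (rfield (fun=> 0)) 0 X 0; first exact: mem0v.
by rewrite velocity_rfield// mem0v.
Qed.

(** * Lists equivalent to R(Z_1), ..., R(Z_m) for a basis Z of g(-1) *)

Variables (m : nat) (Z : m.-tuple g) (D : 'I_m -> fn -> fn) (A B : 'rV[R]_d -> 'M[R[i]]_m).
Hypothesis bZ : basis_of (gr p (-1)) Z.
Hypothesis AB : forall x, A x *m B x = 1%:M.
Hypothesis DE : forall i f, smooth f -> forall x,
  D i f x = \sum_j A x j i * Rdiff e Z`_j f x.

Lemma Z_gr (l : 'I_m) : Z`_l \in gr p (-1).
Proof. by rewrite (basis_mem bZ)// mem_nth ?size_tuple. Qed.

Lemma Z_nilbar (l : 'I_m) : Z`_l \in nilbar p.
Proof. exact/gr_N1_nilbar/Z_gr. Qed.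

Lemma Rdiff_of_D (l : 'I_m) f x : smooth f ->
  Rdiff e Z`_l f x = \sum_i B x i l * D i f x.
Proof.
move=> sf; under eq_bigr do rewrite DE// mulr_sumr.
rewrite exchange_big /=.
transitivity (\sum_j (A x *m B x) j l * Rdiff e Z`_j f x).
  rewrite AB (bigD1 l)//= mxE eqxx mul1r big1 ?addr0// => j jl.
  by rewrite mxE (negPf jl) mul0r.
apply: eq_bigr => j _; rewrite mxE mulr_suml; apply: eq_bigr => i _; ring.
Qed.

Lemma Rdiff_cst (X : g) (a : R[i]) x : X \in nilbar p -> Rdiff e X (fun=> a) x = 0.
Proof.
move=> Xn; rewrite (@Rdiff_vfield (fun=> X))//; last exact: smooth_cst.
exact: vfield_cst.
Qed.

Lemma conformally_invariant_eq0 s : conformally_invariant e lam s D ->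
  (exists X z, [/\ X \in gr p 1, z \in gr p (-1) & dchar lam (br z X) != 0]) -> s = 0.
Proof.
move=> [_ _ inv] [X [z [X1 z1 dn0]]].
have [C [_ HC]] := inv X.
pose u : fn := fun x => s * (charf (Ad_exp (- pt e x) X) : R[i]).
have su : smooth u by apply/smoothZ/gsmooth_Ad.
have D1 i : D i (fun=> 1) = fun=> 0.
  apply/funext => x; rewrite DE; last exact: smooth_cst.
  by rewrite big1// => j _; rewrite Rdiff_cst ?mulr0// Z_nilbar.
have pi1 : pi_s e lam s X (fun=> 1) = u.
  apply/funext => x; rewrite /pi_s Rdiff_cst; last exact: nilbar_part_in.
  by rewrite subr0 mulr1 -charfE.
(* Every D_i kills constants: applied to 1, the commutator is -D_i u and the right-hand side of the
   invariance condition vanishes. *)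
have Du i x : D i u x = 0.
  have := HC i (fun=> 1) (@smooth_cst _ _ 1) x.
  rewrite D1 pi1 {1}/pi_s Rdiff_cst; last exact: nilbar_part_in.
  rewrite mulr0 subr0 sub0r big1 => [/eqP|j _]; last by rewrite D1 mulr0.
  by rewrite oppr_eq0 => /eqP.
(* At the identity, Ad(n^-1) X has derivative -[Z_l, X] along R(Z_l). *)
have Zl (l : 'I_m) : s * (charf (br Z`_l X) : R[i]) = 0.
  have := Rdiff_of_D l 0 su; rewrite [X in _ = X]big1; last first.
    by move=> i _; rewrite Du mulr0.
  rewrite (@Rdiff_vfield (fun=> Z`_l)) ?Z_nilbar//.
  have vZ := velocity_rfield (G := fun=> Z`_l) (x := 0) (Z_nilbar l).
  have [sY dY] := gderiv_Ad X (Z_nilbar l) vZ.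
  rewrite /u vfieldZ; last exact: sY.
  rewrite dY pt0 oppr0 Ad_exp0 linearN /= mulrN => /eqP.
  by rewrite oppr_eq0 => /eqP.
have : s * (charf (br z X) : R[i]) = 0.
  rewrite (coord_basis bZ z1) br_suml linear_sum mulr_sumr big1// => l _.
  by rewrite brZl linearZ /= mulrCA Zl mulr0.
rewrite charfE (par_part_id Knd qh); last first.
  by apply: (subvP (gr_sub_par Knd qh (lexx 0))); rewrite -[0](addNr 1) gr_br.
by move/eqP; rewrite mulf_eq0 (negPf dn0) orbF => /eqP.
Qed.

Hypotheses (sA : mx_smooth A) (sB : mx_smooth B).

Definition Dfield i (k : 'I_d) : fn := fun y => \sum_j A y j i * rfield (fun=> Z`_j) k y.

Lemma smooth_Dfield i k : smooth (Dfield i k).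
Proof.
by apply: smooth_sum => j; apply: smoothM; [exact: sA|exact: smooth_rfield_cst].
Qed.

Lemma D_vfield i f x : smooth f -> D i f x = vfield (Dfield i) f x.
Proof.
move=> sf; rewrite DE// /vfield /Dfield.
under [RHS]eq_bigr do rewrite mulr_suml.
rewrite exchange_big /=; apply: eq_bigr => j _.
rewrite (@Rdiff_vfield (fun=> Z`_j)) ?Z_nilbar// /vfield mulr_sumr.
by apply: eq_bigr => k _; rewrite mulrA.
Qed.

Lemma D_diffop i : is_diffop (D i).
Proof.
exists d, (Dfield i), (fun k => [:: k]); split=> [k|f sf x]; first exact: smooth_Dfield.
exact: D_vfield.
Qed.

(** Tested on coordinate functions, a relation gives zeta + [pt x, zeta] / 2 = 0 with zeta in g(-1).
    So zeta also lies in g(-2), commutes with nbar, and is therefore 0; freeness of Z and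
    invertibility of A do the rest. *)
Lemma D_lin_indep x : lin_indep_at D x.
Proof.
move=> c Hc.
pose u j := \sum_i A x j i * c i.
pose zeta := \sum_j u j *: Z`_j.
have zeta1 : zeta \in gr p (-1) by apply: memv_suml => j _; rewrite memvZ// Z_gr.
have V0 : zeta + 2^-1 *: br (pt e x) zeta = 0.
  rewrite -(@velocity_rfield (fun=> zeta)) ?gr_N1_nilbar// /velocity big1// => k _.
  have := Hc _ (@smooth_coord R d k).
  under eq_bigr => i _ do rewrite (D_vfield i x (@smooth_coord R d k)) vfield_coord.
  move=> H; rewrite [X in X *: _](_ : _ = 0) ?scale0r// -[RHS]H.
  rewrite /rfield /zeta br_sumr scaler_sumr -big_split linear_sum /=.
  under [RHS]eq_bigr do rewrite /Dfield mulr_sumr.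
  rewrite exchange_big /=; apply: eq_bigr => j _.
  rewrite brZr scalerA (mulrC 2^-1) -scalerA -scalerDr linearZ /= /u mulr_suml.
  by apply: eq_bigr => i _; rewrite /rfield; ring.
have zeta2 : zeta = - (2^-1 *: br (pt e x) zeta) by apply/eqP; rewrite -addr_eq0 V0.
have br0 : br (pt e x) zeta = 0.
  rewrite nilbar_br_N2 ?pt_nilbar// zeta2 rpredN rpredZ// nilbar_br ?pt_nilbar//.
  exact: gr_N1_nilbar.
have zeta0 : zeta = 0 by rewrite zeta2 br0 scaler0 oppr0.
have u0 j : u j = 0 by move/freeP: (basis_free bZ) => /(_ u zeta0).
have BA : B x *m A x = 1%:M by apply: mulmx1C.
move=> i; transitivity (\sum_l (B x *m A x) i l * c l).
  rewrite BA (bigD1 i)//= mxE eqxx mul1r big1 ?addr0// => j ji.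
  by rewrite mxE eq_sym (negPf ji) mul0r.
transitivity (\sum_j B x i j * u j).
  under eq_bigr do rewrite mxE mulr_suml.
  rewrite exchange_big /=; apply: eq_bigr => j _; rewrite mulr_sumr.
  by apply: eq_bigr => l _; rewrite mulrA.
by rewrite big1// => j _; rewrite u0 mulr0.
Qed.

(** Brackets of Z_l with degrees 1 and 2 stay in q, so only the component of degree 0
    contributes. *)
Lemma nilbar_part_br (l : 'I_m) X : nilbar_part p (br Z`_l (par_part p X)) \in gr p (-1).
Proof.
have K j V : 0 <= j -> V \in gr p j -> nilbar_part p (br Z`_l V) \in gr p (-1).
  move=> j0 Vj; have zV := gr_br (Z_gr l) Vj.
  have [j00|j1] : j = 0 \/ 1 <= j by lia.
    by move: zV; rewrite j00 addr0 => zV; rewrite (nilbar_part_id Knd qh)// gr_N1_nilbar.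
  rewrite nilbar_part_par ?mem0v//.
  by apply: (subvP (gr_sub_par Knd qh _)) zV; lia.
have := par_part_in X; rewrite (par_gr Knd qh).
move=> /memv_addP[W' /memv_addP[W0 h0 [W1 h1 ->]] [W2 h2 ->]].
rewrite !brDr /nilbar_part !linearD /=.
exact: rpredD (rpredD (K 0 _ isT h0) (K 1 _ isT h1)) (K 2 _ isT h2).
Qed.

Section Bracket.
Variable X : g.
Let Y y := Ad_exp (- pt e y) X.
(** For s = 0 the action of X is the vector field -R(N). *)
Let N y := nilbar_part p (Y y).
Let P (j : 'I_m) y := nilbar_part p (br Z`_j (par_part p (Y y))).

Lemma gderiv_N c x z : z \in nilbar p -> velocity e c x = z + 2^-1 *: br (pt e x) z ->
  gderiv c x N (- nilbar_part p (br z (Y x))).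
Proof.
move=> zn cV; have := gderiv_lin (daddv_pi (nilbar p) (par p)) (gderiv_Ad X zn cV).
by rewrite linearN.
Qed.

Lemma smooth_rfield_N k : smooth (rfield N k).
Proof.
have v0 : velocity e (rfield (fun=> 0)) 0 = 0 + 2^-1 *: br (pt e 0) 0.
  by rewrite velocity_rfield ?mem0v.
by have [] := gderiv_rfield k (gderiv_N (mem0v _) v0).
Qed.

(** For a direction depending on the point, [R(N), R(Z_j)] = R([N, Z_j]) - R(N'), where N' is the
    derivative of N along R(Z_j). It is minus the nbar-part of [Z_j, Y], that is -(P_j + [Z_j, N]),
    so the brackets of N with Z_j cancel. *)
Lemma rfield_bracket (j : 'I_m) k x :
  vfield (rfield N) (rfield (fun=> Z`_j) k) x - vfield (rfield (fun=> Z`_j)) (rfield N k) x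
  = rfield (P j) k x.
Proof.
have Nn : N x \in nilbar p by exact: nilbar_part_in.
have Zn := Z_nilbar j.
have vZ := velocity_rfield (G := fun=> Z`_j) (x := x) Zn.
have [_ ->] := gderiv_rfield k (gderiv_cst (rfield N) x Z`_j).
have [_ ->] := gderiv_rfield k (gderiv_N Zn vZ).
rewrite vZ velocity_rfield// br0r addr0 add0r.
have E1 := N2_br_nilbar (nilbar_br (pt_nilbar x) Nn) Zn.
have E2 := N2_br_nilbar (nilbar_br (pt_nilbar x) Zn) Nn.
rewrite !(brDl, brZl) E1 E2 !scaler0 !addr0.
have W2 := nilbar_br Zn Nn.
have NE : nilbar_part p (br Z`_j (Y x)) = P j x + br Z`_j (N x).
  rewrite -{1}(par_nilbar_part Knd qh (Y x)) brDr [LHS]linearD /=; congr (_ + _).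
  by apply: (nilbar_part_id Knd qh); apply: gr_N2_nilbar.
rewrite NE (brC (N x)) brNr brDr (nilbar_br_N2 (pt_nilbar x) W2) addr0 /rfield -linearB /=.
congr (coord e k _).
set W := br Z`_j _; set Q := br (pt e x) _.
by apply: scalar_ext => f fD fN fZ; rewrite !(fD, fN, fZ); field.
Qed.

(** Leibniz rule for D_i = sum_j A_ji R(Z_j) against -R(N): the first sum comes from differentiating
    the coefficients A_ji, the second from [rfield_bracket]. *)
Lemma commutator_D s i f x : s = 0 -> smooth f ->
  pi_s e lam s X (D i f) x - D i (pi_s e lam s X f) x =
  - \sum_j vfield (rfield N) (fun y => A y j i) x * Rdiff e Z`_j f x
  - \sum_j A x j i * Rdiff e (P j x) f x.
Proof.
move=> -> sf.
have piE h : smooth h -> pi_s e lam 0 X h = fun y => - vfield (rfield N) h y.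
  move=> sh; apply/funext => y; rewrite /pi_s !mul0r sub0r.
  by rewrite (Rdiff_vfield (G := N))//; exact: nilbar_part_in.
have sNf : smooth (vfield (rfield N) f).
  by apply: smooth_vfield => // k; exact: smooth_rfield_N.
have DfE : D i f = vfield (Dfield i) f by apply/funext => y; exact: D_vfield.
have sDf : smooth (vfield (Dfield i) f).
  by apply: smooth_vfield => // k; exact: smooth_Dfield.
rewrite DfE !piE// D_vfield; last exact: smoothN.
rewrite vfieldN// opprK -[LHS]opprK opprD opprK -/(_ - _).
rewrite vfield_bracket//; [|exact: smooth_rfield_N|exact: smooth_Dfield].
rewrite -opprD; congr (- _).
have E k : vfield (rfield N) (Dfield i k) x - vfield (Dfield i) (rfield N k) x =
    \sum_j (vfield (rfield N) (fun y => A y j i) x * rfield (fun=> Z`_j) k x +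
            A x j i * rfield (P j) k x).
  rewrite vfield_sum; last first.
    by move=> j; apply: smoothM; [exact: sA|exact: smooth_rfield_cst].
  have -> : vfield (Dfield i) (rfield N k) x =
      \sum_j A x j i * vfield (rfield (fun=> Z`_j)) (rfield N k) x.
    rewrite /vfield /Dfield; under eq_bigr do rewrite mulr_suml.
    rewrite exchange_big /=; apply: eq_bigr => j _; rewrite mulr_sumr.
    by apply: eq_bigr => l _; rewrite mulrA.
  rewrite -sumrB; apply: eq_bigr => j _.
  rewrite vfieldM; [|exact: sA|exact: smooth_rfield_cst].
  by rewrite -rfield_bracket; ring.
under eq_bigr do rewrite E mulr_suml.
rewrite exchange_big -big_split; apply: eq_bigr => j _ /=.
rewrite (@Rdiff_vfield (fun=> Z`_j)) ?Z_nilbar//.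
rewrite (Rdiff_vfield (G := P j))//; last exact: nilbar_part_in.
rewrite /vfield !mulr_sumr -big_split; apply: eq_bigr => k _ /=; ring.
Qed.

End Bracket.

Lemma conformally_invariant0 : conformally_invariant e lam 0 D.
Proof.
split=> [i|x|X]; [exact: D_diffop|exact: D_lin_indep|].
pose Y y := Ad_exp (- pt e y) X.
pose N y := nilbar_part p (Y y).
pose P (j : 'I_m) y := nilbar_part p (br Z`_j (par_part p (Y y))).
(* Column i of M expresses the commutator through the R(Z_l), with P_j in g(-1) expanded in the
   basis Z; multiplication by B converts the R(Z_l) back to the D_j. *)
pose M y : 'M[R[i]]_m := \matrix_(l, i) (- vfield (rfield N) (fun y => A y l i) y
  - \sum_j A y j i * coord Z l (P j y)).
exists (fun y => B y *m M y); split=> [j i|i f sf x].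
  have -> : (fun y => (B y *m M y) j i) = fun y => \sum_l B y j l *
      (- vfield (rfield N) (fun y => A y l i) y - \sum_j A y j i * coord Z l (P j y)).
    by apply/funext => y; rewrite mxE; apply: eq_bigr => l _; rewrite mxE.
  apply: smooth_sum => l; apply: smoothM; first exact: sB.
  apply: smoothB.
    by apply/smoothN/smooth_vfield; [move=> k; exact: smooth_rfield_N|exact: sA].
  apply: smooth_sum => j'; apply: smoothM; first exact: sA.
  have -> : (fun y => coord Z l (P j' y)) = fun y =>
    ((coordf Z l \o (daddv_pi (nilbar p) (par p) \o (ad Z`_j' \o daddv_pi (par p) (nilbar p))))%VF
      (Y y) : R[i]).
    by apply/funext => y; rewrite !comp_lfunE coordfE adE.
  exact: gsmooth_Ad.
rewrite commutator_D//.
transitivity (\sum_l M x l i * Rdiff e Z`_l f x); last first.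
  under eq_bigr do rewrite Rdiff_of_D// mulr_sumr.
  rewrite exchange_big /=; apply: eq_bigr => j _; rewrite mxE mulr_suml.
  by apply: eq_bigr => l _; rewrite mulrA (mulrC (B x j l)).
under [RHS]eq_bigr do rewrite mxE mulrBl mulNr.
rewrite sumrB sumrN; congr (_ - _).
under [RHS]eq_bigr do rewrite mulr_suml.
rewrite exchange_big; apply: eq_bigr => j _ /=.
rewrite {1}(coord_basis bZ (nilbar_part_br j _)) RdiffZ_sum mulr_sumr.
by apply: eq_bigr => l _; rewrite mulrA.
Qed.

End BundleCalculus.

(** For k = 0 the tensor omega would be zero, contrary to the nonzero pairing in
    [special_constituent]; otherwise the first pair of dual vectors has Killing product 1. *)
Lemma omega_killing_neq0 (R : realType) (g : lieAlg R[i]%C) (p : maxParabolic g) w V :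
  is_omega p w -> special_constituent p w V -> exists x y : g, killing x y <> 0.
Proof.
move=> [[|k] [X [Xs [_ _ dual ->]]]] [_ [Y [x [_ _ ne0]]]].
  case: ne0; rewrite big_ord0 /tau1 /adl mulmx0 /tpair mulmx0 mul0mx; exact: linear0.
by exists Xs`_(@ord0 k), X`_(@ord0 k); rewrite dual eqxx; apply/eqP/oner_neq0.
Qed.

Theorem theorem5p7 (R : realType) (g : lieAlg R[i]) (p : maxParabolic g)
    (lam : 'Hom(subvs_of (csa p), R[i]^o))
    (g0 : set g) (d : nat) (e : d.-tuple g)
    (s : R[i]) (m : nat) (D : 'I_m -> ('rV[R]_d -> R[i]) -> ('rV[R]_d -> R[i])) :
  simple_lie g ->
  quasi_heisenberg p ->
  is_fund_weight lam ->
  real_form_lie g0 ->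
  real_form_of (real_points g0 (par p)) (par p) ->
  real_form_of (real_points g0 (nilbar p)) (nilbar p) ->
  real_basis (real_points g0 (nilbar p)) e ->
  Omega1_system p e D ->
  (conformally_invariant e lam s D <-> s = 0).
Proof.
move=> gsimple qh fund [_ g0br] _ nreal ebasis.
move=> [w [V [Y [Z [om sp bY HZ [A [B [sA sB AB DE]]]]]]]].
have Knd := killing_nondeg gsimple (omega_killing_neq0 om sp).
have bZ : basis_of (gr p (-1)) Z.
  apply: (Omega1_basis _ (@gr_br _ _ p) _ om sp bY HZ).
    by move=> x; exact: (killing_gr_nondeg Knd).
  exact: (gr_N1_irreducible Knd).
have eb := real_basis_complex nreal ebasis.
(* Both [g0] and nbar are closed under brackets, so the structure constants of e are real. *)
have ereal (i j k : 'I_d) : coord e k (br e`_i e`_j) \is Num.real.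
  have [Se _] := ebasis; have [Si ni] := Se i; have [Sj nj] := Se j.
  apply: (coord_real_basis _ eb ebasis); split; first exact: g0br.
  exact: (gr_N2_nilbar Knd qh (nilbar_br Knd qh ni nj)).
split=> [inv|->].
  apply: (conformally_invariant_eq0 Knd qh eb ereal bZ AB DE inv).
  exact: (fund_weight_br Knd fund).
exact: (conformally_invariant0 Knd qh eb ereal lam bZ AB DE sA sB).
Qed.
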